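(* There is an algorithm which, given an injective morphism $\sigma\colon A^*\to B^*$ between free monoids on finite alphabets, decides whether $\sigma$ is recognizable for aperiodic points (on the full shift $A^{\mathbb Z}$), in time quadratic in the size of $\sigma(A)$.
   Context: The size of a finite set of words is the sum of the lengths of its words; $\sigma(A)=\{\sigma(a)\mid a\in A\}$. $S$ denotes the shift transformation, $S(x)_n=x_{n+1}$. A point $y\in B^{\mathbb Z}$ is aperiodic if $S^n(y)\neq y$ for all $n\ge1$. For $x\in A^{\mathbb Z}$, $\sigma(x)=\cdots\sigma(x_{-1})\cdot\sigma(x_0)\sigma(x_1)\cdots$. A centered $\sigma$-representation of $y\in B^{\mathbb Z}$ is a pair $(x,k)$ with $x\in A^{\mathbb Z}$, $y=S^k(\sigma(x))$ and $0\le k<|\sigma(x_0)|$. The morphism $\sigma$ is recognizable for aperiodic points if every aperiodic $y\in B^{\mathbb Z}$ has at most one centered $\sigma$-representation. *)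

(* Defs.v *)
From mathcomp Require Import all_boot all_order all_algebra.

Set Implicit Arguments.
Unset Strict Implicit.
Unset Printing Implicit Defensive.

(* [seq A] is the free monoid on [A]. *)
Definition free_monoid_morphism (A B : Type) (sigma : seq A -> seq B) : Prop :=
  sigma [::] = [::] /\ {morph sigma : u v / u ++ v}.

Definition biinf (T : Type) := int -> T.

Definition shift (T : Type) (x : biinf T) : biinf T := fun n => x (n + 1)%R.

(* Points are compared with [=1], so no function extensionality is involved. *)
Definition aperiodic (T : Type) (y : biinf T) : Prop :=
  forall n : nat, 1 <= n -> ~ (iter n (@shift T) y =1 y).

(* The word y_i y_(i+1) ... y_(i+n-1). *)
Definition factor (T : Type) (y : biinf T) (i : int) (n : nat) : seq T :=
  mkseq (fun j => y (i + j%:Z)%R) n.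

(* [z] is the point sigma(x) = ... sigma(x_(-1)) . sigma(x_0) sigma(x_1) ...
   This is a relation since for an erasing sigma the concatenation may fail to
   be infinite on both sides; the last two conditions exclude that case, and
   make [z] unique when it exists. *)
Definition is_image (A B : Type) (sigma : seq A -> seq B)
    (x : biinf A) (z : biinf B) : Prop :=
  let right n := sigma (factor x 0%R n) in
  let left n := sigma (factor x (- n%:Z)%R n) in
  [/\ forall n, right n = factor z 0%R (size (right n)),
      forall n, left n = factor z (- (size (left n))%:Z)%R (size (left n)),
      forall N, exists n, N <= size (right n) &
      forall N, exists n, N <= size (left n)].

Definition centered_representation (A B : Type) (sigma : seq A -> seq B)
    (y : biinf B) (x : biinf A) (k : nat) : Prop :=
  (exists z : biinf B, is_image sigma x z /\ y =1 iter k (@shift B) z) /\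
  k < size (sigma [:: x 0%R]).

Definition recognizable_for_aperiodic_points (A B : Type)
    (sigma : seq A -> seq B) : Prop :=
  forall y : biinf B, aperiodic y ->
  forall (x x' : biinf A) (k k' : nat),
    centered_representation sigma y x k ->
    centered_representation sigma y x' k' ->
    x =1 x' /\ k = k'.

(* [undup] makes sigma(A) a set of words. *)
Definition letter_images (A B : finType) (sigma : seq A -> seq B) :
    seq (seq B) :=
  undup [seq sigma [:: a] | a <- enum A].

Definition words_size (T : Type) (X : seq (seq T)) : nat :=
  \sum_(w <- X) size w.

(* While programs on a random access machine with registers and an indirectly
   addressed memory. An expression occurring in a program has a fixed size and
   reads registers only, so each step below amounts to a bounded number of
   elementary instructions. Every stored value and every address must be at
   most [W], otherwise the machine crashes; with [W] polynomial in the
   length of the input and the size of its alphabet, the machine words have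
   logarithmically many bits, which makes the unit cost
   of the arithmetic operations realistic. *)

Inductive binop := OpAdd | OpSub | OpMul | OpDiv | OpMod | OpLt | OpEq.

Inductive expr :=
  | EReg of nat
  | EConst of nat
  | EBin of binop & expr & expr.

Inductive cmd :=
  | CAssign of nat & expr
  | CFetch of nat & expr
  | CStore of expr & expr
  | CSeq of cmd & cmd
  | CIf of expr & cmd & cmd
  | CWhile of expr & cmd.

Record store := MkStore { regs : nat -> nat; mem : nat -> nat }.

Definition update (f : nat -> nat) (i v : nat) : nat -> nat :=
  fun j => if j == i then v else f j.

Definition eval_binop (o : binop) (u v : nat) : nat :=
  match o with
  | OpAdd => u + v
  | OpSub => u - v
  | OpMul => u * v
  | OpDiv => u %/ v
  | OpMod => u %% v
  | OpLt => u < v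
  | OpEq => u == v
  end.

Fixpoint eval (s : store) (e : expr) : nat :=
  match e with
  | EReg r => regs s r
  | EConst n => n
  | EBin o e1 e2 => eval_binop o (eval s e1) (eval s e2)
  end.

(* A configuration is the stack of commands still to be executed, with the
   store; the machine has halted when the stack is empty. *)
Definition config := (seq cmd * store)%type.

(* [None] is a crash; a halted configuration is left unchanged. *)
Definition step (W : nat) (c : config) : option config :=
  let: (k, s) := c in
  match k with
  | [::] => Some c
  | CAssign r e :: k' =>
      let v := eval s e in
      if v <= W then Some (k', MkStore (update (regs s) r v) (mem s)) else None
  | CFetch r e :: k' =>
      let i := eval s e in
      let v := mem s i in
      if (i <= W) && (v <= W)
      then Some (k', MkStore (update (regs s) r v) (mem s)) else None
  | CStore e1 e2 :: k' =>
      let i := eval s e1 in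
      let v := eval s e2 in
      if (i <= W) && (v <= W)
      then Some (k', MkStore (regs s) (update (mem s) i v)) else None
  | CSeq p1 p2 :: k' => Some (p1 :: p2 :: k', s)
  | CIf e p1 p2 :: k' => Some ((if eval s e != 0 then p1 else p2) :: k', s)
  | CWhile e p :: k' =>
      Some (if eval s e != 0 then p :: CWhile e p :: k' else k', s)
  end.

Definition run (W t : nat) (c : config) : option config :=
  iter t (obind (step W)) (Some c).

Definition initial_config (p : cmd) (input : seq nat) : config :=
  ([:: p], MkStore (fun=> 0) (nth 0 input)).

(* Started on [input], [p] halts after at most [t] steps without crashing,
   with [out] in register 0. *)
Definition computes_within (W : nat) (p : cmd) (input : seq nat)
    (t out : nat) : Prop :=
  exists s : store,
    run W t (initial_config p input) = Some ([::], s) /\ regs s 0 = out.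

(* The sequence |A|, |B|, followed, for each letter a of A, by |sigma(a)| and
   the letters of sigma(a), each being given by its rank in B. *)
Definition encode (A B : finType) (sigma : seq A -> seq B) : seq nat :=
  [:: #|A|, #|B| &
    flatten [seq size (sigma [:: a]) ::
                 [seq (enum_rank b : nat) | b <- sigma [:: a]] | a <- enum A]].

(* Main.v *)
Require Import Defs.
From mathcomp Require Import all_boot all_order all_algebra.
From mathcomp Require Import zify.
From Stdlib Require Import Classical.

(** Injectivity makes the letters of A correspond to non-empty words, so that a
    centered representation of y is a way of cutting y into words of sigma(A).
    Write these words one after the other: this is a text of length n, whose
    positions are called occurrences.  A cutting of y becomes a bi-infinite
    sequence o of occurrences, where o m is the one that produces y_m: each
    occurrence is followed by the next one in its word or, at the end of the
    word, by the start of any word.  In other words, o is a path of an automaton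
    whose nodes are the inner positions of the words and one node 0 for all the
    boundaries between words.

    Two cuttings of the same point are a path of the product of this automaton
    with itself.  Its nodes are pairs of nodes, and its edges are the pairs (i, j)
    of occurrences of the same letter; there are at most n^2 of each.  Among the
    diagonal edges (i, i) only those of the first word are kept.  They form a
    cycle through (0, 0), which represents two cuttings that coincide from some
    position on.  Let E be the largest set of nodes in which every node has a
    successor and a predecessor.  Then sigma is recognizable for aperiodic
    points if and only if no node of E is the source of two edges that end in E.

    Assume that no node of E branches ([deterministic_recognizable]).  By counting,
    no two edges inside E have the same target either, so that the path that two
    cuttings describe is determined by any of its edges, in both directions.  If
    the cuttings differ somewhere, they cannot meet, since the path would then be
    the cycle of the first word.  Hence they describe a path inside the finite
    set E, which is periodic, and so is the point that is cut.

    Assume that sigma is recognizable ([recognizable_deterministic]).  Two edges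
    inside E with the same source extend to two bi-infinite paths with the same
    left half.  The label of such a path is always a periodic point: otherwise
    its two cuttings are equal, the path is diagonal, and it goes round the first
    word.  By injectivity, a cutting of a periodic point is periodic as well
    ([parsing_periodic]).  Periodic paths with the same left half are equal, and
    so are the two edges.

    The set E is computed by removing, as long as there is one, a node that has
    lost all its outgoing edges or all its incoming ones.  The degrees are kept
    in two tables and the removed nodes in a queue.  The edges at (x, y) are
    found by testing all the pairs (i, j) where i is the only occurrence next to x
    if x is not 0, any occurrence if x is 0, and likewise for j and y.  This is
    n + (n - 1) possibilities for each of x and y, hence less than (2 n)^2 tests
    for all the outgoing edges, and as many for the incoming ones
    ([remaining_le]).  The correctness and the running time of the
    program are proved together, by a weakest precondition calculus whose
    assertions mention the time that is left ([wp]). *)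

Set Implicit Arguments.
Unset Strict Implicit.
Unset Printing Implicit Defensive.

(** * Counting arguments *)

Lemma infinite_pigeonhole (T : finType) (R : T -> nat -> Prop) :
  (forall m, exists k, R k m) -> exists k, forall N, exists2 m, N <= m & R k m.
Proof.
move=> R_total; apply: NNPP => noR.
have bounded k : exists N, forall m, N <= m -> ~ R k m.
  apply: NNPP => unbounded; apply: noR; exists k => N.
  apply: NNPP => noRm; apply: unbounded; exists N => m Nm Rkm.
  by apply: noRm; exists m.
have [N N_bound] := fin_all_exists bounded.
have [k Rk] := R_total (\max_k N k).
by apply: (N_bound k) Rk; exact: leq_bigmax.
Qed.

Lemma uniq_map_inj (T U : eqType) (f : T -> U) (s : seq T) :
  uniq (map f s) -> {in s &, injective f}.
Proof.
elim: s => [//|x s IHs] /= /andP[fx_s /IHs inj_f] y z.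
rewrite !inE => /predU1P[->|ys] /predU1P[->|zs] // eq_f.
- by rewrite eq_f map_f in fx_s.
- by rewrite -eq_f map_f in fx_s.
- exact: inj_f.
Qed.

(** Both images have the same number of elements, which for [f] is that of [s]. *)
Lemma same_image_inj (T U : eqType) (f g : T -> U) (s : seq T) : uniq s ->
  {in s &, injective f} -> map f s =i map g s -> {in s &, injective g}.
Proof.
move=> s_uniq inj_f eq_fg; apply: uniq_map_inj.
by rewrite -(eq_uniq _ eq_fg) ?map_inj_in_uniq // !size_map.
Qed.

(** * The graph of pairs of occurrences *)

(** Node 0 stands for all the boundaries between words, including the end of the
    text: the node reached after occurrence [k] is always that of [k.+1]. *)
Definition word_node (sh : seq nat) (k : nat) : nat :=
  if (k < sumn sh) && (reshape_offset sh k != 0) then k else 0.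

Section PairGraph.

Variables (n first : nat) (letter node : nat -> nat).

(** The diagonal is reduced to one cycle because the node (0, 0) would otherwise
    branch whenever there are two words. *)
Definition pair_edge (e : nat * nat) : bool :=
  [&& e.1 < n, e.2 < n, letter e.1 == letter e.2
    & (e.1 != e.2) || (e.1 < first)].

(** The source of [e] for [d = 0] and its target for [d = 1]; a pair of nodes is
    coded by one number below [n * n], for use as an index of arrays. *)
Definition pair_node (d : nat) (e : nat * nat) : nat :=
  node (e.1 + d) * n + node (e.2 + d).

(** The nodes that lie on bi-infinite paths.  Maximality is required with respect
    to arbitrary predicates because it is applied to the nodes that two given
    cuttings visit, which is not a decidable set. *)
Record essential (E : pred nat) : Prop := Essential {
  essential_succ v : E v ->
    exists e, [/\ pair_edge e, pair_node 0 e = v & E (pair_node 1 e)];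
  essential_pred v : E v ->
    exists e, [/\ pair_edge e, pair_node 1 e = v & E (pair_node 0 e)];
  essential_max (T : nat -> Prop) :
    (forall v, T v ->
      exists e, [/\ pair_edge e, pair_node 0 e = v & T (pair_node 1 e)]) ->
    (forall v, T v ->
      exists e, [/\ pair_edge e, pair_node 1 e = v & T (pair_node 0 e)]) ->
    forall v, T v -> E v }.

Definition inner_edge (E : pred nat) (e : nat * nat) : bool :=
  [&& pair_edge e, E (pair_node 0 e) & E (pair_node 1 e)].

Definition deterministic (E : pred nat) : Prop :=
  forall e e', inner_edge E e -> inner_edge E e' ->
    pair_node 0 e = pair_node 0 e' -> e = e'.

Definition edges : seq (nat * nat) :=
  [seq e <- [seq (i, j) | i <- iota 0 n, j <- iota 0 n] | pair_edge e].

Lemma mem_edges e : (e \in edges) = pair_edge e.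
Proof.
rewrite mem_filter; case: e => i j;
  have [/and4P[/= lt_i lt_j _ _]|//] := boolP (pair_edge _).
by apply/allpairsP; exists (i, j); rewrite !mem_iota.
Qed.

Lemma edges_uniq : uniq edges.
Proof. by apply/filter_uniq/allpairs_uniq;
  rewrite ?iota_uniq // => -[? ?] [? ?] _ _ [-> ->]. Qed.

End PairGraph.

(** * Occurrences of letters in the words of the code *)

Section Occurrences.

Variables (A B : finType) (sigma : seq A -> seq B).
Hypothesis sigma_morph : free_monoid_morphism sigma.
Hypothesis sigma_inj : injective sigma.

Definition word (a : A) : seq B := sigma [:: a].

Definition words : seq (seq B) := [seq word a | a <- enum A].

Definition text : seq B := flatten words.

Definition occ (a : A) (i : nat) : nat :=
  flatten_index (shape words) (enum_rank a) i.

Definition letter (k : nat) : nat := nth 0 [seq (enum_rank b : nat) | b <- text] k.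

Definition node : nat -> nat := word_node (shape words).

Lemma sigma_cons a w : sigma (a :: w) = word a ++ sigma w.
Proof. by rewrite -cat1s sigma_morph.2. Qed.

Lemma word_gt0 a : 0 < size (word a).
Proof.
rewrite lt0n; apply/negP => /nilP wa0.
by have := @sigma_inj [:: a] [::]; rewrite sigma_morph.1 -/(word a) wa0 => /(_ erefl).
Qed.

Lemma size_shape_words : size (shape words) = #|A|.
Proof. by rewrite /shape 2!size_map cardE. Qed.

Lemma nth_words a : nth [::] words (enum_rank a) = word a.
Proof.
by rewrite (nth_map a) ?nth_enum_rank // -cardE ltn_ord.
Qed.

Lemma nth_shape a : nth 0 (shape words) (enum_rank a) = size (word a).
Proof.
by rewrite (nth_map [::]) ?nth_words // -(size_map size) size_shape_words ltn_ord.
Qed.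

Lemma size_text : size text = sumn (shape words).
Proof. exact: size_flatten. Qed.

Lemma occ_lt a i : i < size (word a) -> occ a i < size text.
Proof. by rewrite size_text -nth_shape => /flatten_indexP. Qed.

Lemma occS a i : occ a i.+1 = (occ a i).+1.
Proof. by rewrite /occ /flatten_index addnS. Qed.

Lemma occ_inj a a' i i' : i < size (word a) -> i' < size (word a') ->
  occ a i = occ a' i' -> a = a' /\ i = i'.
Proof.
rewrite -!nth_shape => ia ia' eq_occ.
have := congr1 (reshape_index (shape words)) eq_occ.
rewrite !flatten_indexKl // => /val_inj/enum_rank_inj ->.
have := congr1 (reshape_offset (shape words)) eq_occ.
by rewrite !flatten_indexKr.
Qed.

Lemma occP k : k < size text ->
  exists a i, i < size (word a) /\ k = occ a i.
Proof.
rewrite size_text => lt_k.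
have := reshape_indexP lt_k; rewrite size_shape_words => lt_r.
exists (enum_val (Ordinal lt_r)), (reshape_offset (shape words) k).
rewrite -nth_shape /occ enum_valK; split; first exact: reshape_offsetP.
by rewrite reshape_indexK.
Qed.

Lemma node_occ a i : i < size (word a) -> node (occ a i) = if i == 0 then 0 else occ a i.
Proof.
move=> ia; rewrite /node /word_node -size_text occ_lt // /occ flatten_indexKr ?nth_shape
  //.
by case: eqP.
Qed.

Lemma node_occS a i : i < size (word a) ->
  node (occ a i).+1 = if i.+1 == size (word a) then 0 else (occ a i).+1.
Proof.
move=> ia; rewrite -occS; case: eqP => [last_i|/eqP nlast]; last first.
  by rewrite node_occ // ltn_neqAle nlast.
have eq_next : occ a i.+1 = flatten_index (shape words) (enum_rank a).+1 0.
  rewrite /occ /flatten_index addn0 (take_nth 0); last first.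
    by rewrite size_shape_words ltn_ord.
  by rewrite sumn_rcons nth_shape last_i.
have [lt_r|ge_r] := ltnP (enum_rank a).+1 #|A|; last first.
  rewrite /node /word_node ifF // eq_next /flatten_index addn0 take_oversize; last first.
    by rewrite size_shape_words.
  by rewrite ltnn.
have := node_occ (word_gt0 (enum_val (Ordinal lt_r))).
by rewrite /occ enum_valK /= -eq_next.
Qed.

Lemma node_id k : node k != 0 -> node k = k.
Proof. by rewrite /node /word_node; case: ifP. Qed.

Lemma node_lt k : k <= size text -> 0 < size text -> node k < size text.
Proof. by rewrite /node /word_node size_text; case: ifP => // /andP[]. Qed.

Lemma letter_occ a i b0 : i < size (word a) ->
  letter (occ a i) = enum_rank (nth b0 (word a) i).
Proof.
move=> ia; rewrite /letter (nth_map b0) ?occ_lt //.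
by rewrite nth_flatten /occ flatten_indexKl ?flatten_indexKr ?nth_shape // nth_words.
Qed.

(** * Cuttings of a point as paths *)

(** A cutting of a bi-infinite word into words of the code. *)
Definition parsing (o : biinf nat) : Prop :=
  forall m, o m < size text /\ node (o m).+1 = node (o (m + 1)%R).

Definition parses (o : biinf nat) (y : biinf B) : Prop :=
  forall m, letter (o m) = enum_rank (y m).

Lemma parsing_occ o m : parsing o -> exists a i, i < size (word a) /\ o m = occ a i.
Proof. by move=> /(_ m)[lt_o _]; exact: occP. Qed.

Lemma node_eq0 a i : i < size (word a) -> (node (occ a i) == 0) = (i == 0).
Proof.
by move=> ia; rewrite node_occ //; case: i ia => // i ia; rewrite occS.
Qed.

Lemma parsing_next o m a i : parsing o -> o m = occ a i -> i.+1 < size (word a) ->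
  o (m + 1)%R = occ a i.+1.
Proof.
move=> /(_ m)[_]; move=> nodeE om ia.
move: nodeE; rewrite om node_occS ?(ltnW ia) // ltn_eqF // => nodeE.
by rewrite occS nodeE node_id // -nodeE.
Qed.

Lemma parsing_last o m a i : parsing o -> o m = occ a i -> i.+1 = size (word a) ->
  node (o (m + 1)%R) = 0.
Proof.
move=> /(_ m)[_ nodeE] om ia.
by rewrite -nodeE om node_occS -?ia // eqxx.
Qed.

Lemma parsing_prev o m a i : parsing o -> o (m + 1)%R = occ a i.+1 ->
  i.+1 < size (word a) -> o m = occ a i.
Proof.
move=> /(_ m)[_ nodeE] om ia.
move: nodeE; rewrite om node_occ //= => nodeE.
by have := node_id (k := (o m).+1); rewrite nodeE !occS => /(_ isT)[].
Qed.

Lemma parsing_forward o m a i j : parsing o -> o m = occ a i -> i + j < size (word a) ->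
  o (m + j%:Z)%R = occ a (i + j).
Proof.
move=> po om; elim: j => [|j IHj] ij; first by rewrite addn0 GRing.addr0.
have -> : (m + j.+1%:Z)%R = (m + j%:Z + 1)%R by lia.
by rewrite (parsing_next po (IHj _)) ?addnS //; lia.
Qed.

Lemma parsing_backward o m a i j : parsing o -> o m = occ a i -> i < size (word a) ->
  j <= i -> o (m - j%:Z)%R = occ a (i - j).
Proof.
move=> po om ia; elim: j => [|j IHj] ij; first by rewrite subn0 GRing.subr0.
apply: parsing_prev => //; last by lia.
have -> : (m - j.+1%:Z + 1)%R = (m - j%:Z)%R by lia.
by rewrite IHj ?(ltnW ij) //; congr occ; lia.
Qed.

Lemma node0_occ k : k < size text -> node k = 0 -> exists a, k = occ a 0.
Proof.
move=> /occP[a [i [ia ->]]] /eqP; rewrite node_eq0 // => /eqP ->.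
by exists a.
Qed.

Definition occs (w : seq A) : seq nat :=
  flatten [seq mkseq (occ a) (size (word a)) | a <- w].

Lemma letter_occs w : [seq letter k | k <- occs w] = [seq (enum_rank b : nat) | b <-
  sigma w].
Proof.
elim: w => [|a w IHw]; first by rewrite sigma_morph.1.
rewrite sigma_cons !map_cat IHw; congr (_ ++ _).
have [b0 _] : exists b : B, b \in word a.
  by case: (word a) (word_gt0 a) => // b s _; exists b; rewrite mem_head.
apply: (@eq_from_nth _ 0) => [|i]; first by rewrite !size_map size_iota.
rewrite !size_map size_iota => ia.
rewrite (nth_map 0) ?size_map ?size_iota // nth_mkseq // (letter_occ b0) //.
by rewrite (nth_map b0).
Qed.

Lemma factorD (T : Type) (y : biinf T) m i j :
  factor y m (i + j) = factor y m i ++ factor y (m + i%:Z)%R j.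
Proof.
rewrite /factor /mkseq iotaD map_cat add0n; congr (_ ++ _).
rewrite -{1}(addn0 i) iotaDl -map_comp; apply: eq_map => k /=.
by congr y; lia.
Qed.

Lemma nth_factor (T : Type) x0 (y : biinf T) m l i : i < l ->
  nth x0 (factor y m l) i = y (m + i%:Z)%R.
Proof. by move=> il; rewrite nth_mkseq. Qed.

Lemma size_factor (T : Type) (y : biinf T) m l : size (factor y m l) = l.
Proof. exact: size_mkseq. Qed.

(** A finite part of a parsing comes from a word over A, to which the injectivity
    of sigma can be applied. *)
Lemma parsing_window o m l : parsing o ->
  node (o m) = 0 -> node (o (m + l%:Z)%R) = 0 -> exists w, factor o m l = occs w.
Proof.
move=> po; elim/ltn_ind: l m => l IHl m om0 ol0.
have [a oma] := node0_occ (po m).1 om0.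
case: (posnP l) => [->|l_gt0]; first by exists [::].
have o_a j : j < size (word a) -> o (m + j%:Z)%R = occ a j.
  by move=> ja; rewrite -[j in RHS]add0n; apply: parsing_forward.
have [la|al] := ltnP l (size (word a)).
  by have := node_eq0 la; rewrite -o_a // ol0 eqxx => /esym/eqP l0; lia.
have := word_gt0 a; set s := size (word a) in o_a al * => s_gt0.
have om_s : node (o (m + s%:Z)%R) = 0.
  have -> : (m + s%:Z)%R = (m + s.-1%:Z + 1)%R by lia.
  by apply: (parsing_last (a := a) (i := s.-1)) => //; [apply: o_a; lia|exact: prednK].
have [||w ew] := IHl (l - s) _ (m + s%:Z)%R om_s; first by lia.
  by rewrite -[RHS]ol0; congr (node (o _)); lia.
exists (a :: w); rewrite -{1}(subnKC al) factorD ew; congr (_ ++ _).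
by apply/eq_in_map => j; rewrite mem_iota => /= jl; rewrite o_a.
Qed.

(** As the two parsings agree at both ends of the window, they have the same
    boundary just before it and the same boundary just after it.  Between these
    boundaries they decode the same word, so that injectivity applies. *)
Lemma parsing_agree_between o o' (m m' : int) : parsing o -> parsing o' ->
  (forall t, letter (o t) = letter (o' t)) ->
  (m <= m')%R -> o m = o' m -> o m' = o' m' ->
  forall t : int, (m <= t <= m')%R -> o t = o' t.
Proof.
move=> po po' eq_l le_mm' om om' t mtm'.
have [a [i [ia oma]]] := parsing_occ m po.
have [a' [i' [ia' oma']]] := parsing_occ m' po.
have start p : parsing p -> p m = occ a i -> node (p (m - i%:Z)%R) = 0.
  move=> pp pm; rewrite (parsing_backward pp pm) // subnn.
  by apply/eqP; rewrite node_eq0 // word_gt0.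
set s := size (word a') in ia'.
have stop p : parsing p -> p m' = occ a' i' -> node (p (m' + (s - i')%:Z)%R) = 0.
  move=> pp pm'.
  have -> : (m' + (s - i')%:Z = m' + (s - i').-1%:Z + 1)%R by lia.
  apply: (parsing_last (a := a') (i := s.-1)) => //; last by rewrite -/s; lia.
  by rewrite (parsing_forward pp pm'); [congr occ; lia|rewrite -/s; lia].
set c := (m - i%:Z)%R in start.
pose l := absz (m' + (s - i')%:Z - c)%R.
have el : (m' + (s - i')%:Z = c + l%:Z)%R by lia.
have windowP p : parsing p -> p m = occ a i -> p m' = occ a' i' ->
    exists w, factor p c l = occs w.
  move=> pp pm pm'; apply: parsing_window => //; first exact: start.
  by rewrite -el; exact: stop.
have [w ew] := windowP _ po oma oma'.
have [w' ew'] := windowP _ po' (etrans (esym om) oma) (etrans (esym om') oma').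
have eq_ww' : w' = w.
  have rank_inj : injective (fun b : B => enum_rank b : nat).
    by move=> b b' /val_inj/enum_rank_inj.
  apply/sigma_inj/(inj_map rank_inj); rewrite -!letter_occs -ew -ew' -!map_comp.
  by apply: eq_map => j /=.
rewrite eq_ww' -ew in ew'.
have := congr1 (fun u => nth 0 u (absz (t - c))) ew'.
by rewrite !nth_factor; [have -> : (c + absz (t - c) = t)%R by lia|lia..].
Qed.

(** * Cuttings of periodic points *)

Lemma parsing_shift o p : parsing o -> parsing (fun m => o (m + p)%R).
Proof.
move=> po m; split; first by case: (po (m + p)%R).
by rewrite (po _).2; congr (node (o _)); lia.
Qed.

Definition label_period (o : biinf nat) (P : nat) : Prop :=
  forall m, letter (o (m + P%:Z)%R) = letter (o m).

Lemma label_periodM o P k : label_period o P -> label_period o (k * P).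
Proof.
move=> oP m; elim: k => [|k IHk]; first by rewrite mul0n GRing.addr0.
have -> : (m + (k.+1 * P)%:Z = m + (k * P)%:Z + P%:Z)%R by lia.
by rewrite oP.
Qed.

(** There are fewer occurrences than translates of [o] by 0, P, ..., n P.  Hence two of
    these translates agree at any given position, and some two agree infinitely
    often; [dir] tells on which side. *)
Lemma parsing_recurrent (dir : bool) o P : parsing o -> 0 < P -> label_period o P ->
  exists Q, [/\ 0 < Q, label_period o Q &
    forall N, exists2 t : int, (N%:Z <= if dir then t else - t)%R & o (t + Q%:Z)%R = o t].
Proof.
move=> po P_gt0 oP.
pose at_ (m : nat) (i : nat) : int := ((if dir then m%:Z else - m%:Z) + (i * P)%:Z)%R.
have [[i j] /= recij] : exists k : 'I_(size text).+1 * 'I_(size text).+1,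
    forall N, exists2 m, N <= m & k.1 < k.2 /\ o (at_ m k.1) = o (at_ m k.2).
  apply: infinite_pigeonhole => m.
  pose f (i : 'I_(size text).+1) : 'I_(size text) := Ordinal (po (at_ m i)).1.
  have /injectivePn[i [j neq_ij /(congr1 val)/= fij]] : ~~ injectiveb f.
    apply/negP => /injectiveP/leq_card; rewrite !card_ord.
    by rewrite ltnn.
  have [lt_ij|lt_ji|/val_inj eq_ij] := ltngtP i j.
  - by exists (i, j).
  - by exists (j, i).
  - by rewrite eq_ij eqxx in neq_ij.
have [_ _ [lt_ij _]] := recij 0.
exists ((j - i) * P); split; first by rewrite muln_gt0 subn_gt0 lt_ij.
  exact: label_periodM.
move=> N; have [m Nm [_ eq_o]] := recij (N + i * P).
exists (at_ m i); first by rewrite /at_; case: (dir); nia.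
by rewrite eq_o; congr o; rewrite /at_; nia.
Qed.

(** By recurrence and [parsing_agree_between], [o] has a period far to the right
    and another one far to the left.  The translate of [o] by a common multiple of
    them agrees with [o] on both sides, hence everywhere. *)
Lemma parsing_periodic o P : parsing o -> 0 < P -> label_period o P ->
  exists2 Q, 0 < Q & forall m, o (m + Q%:Z)%R = o m.
Proof.
move=> po P_gt0 oP.
have [Q [Q_gt0 oQ recQ]] := parsing_recurrent true po P_gt0 oP.
have [R [R_gt0 oR recR]] := parsing_recurrent false po P_gt0 oP.
have [q _ oq] := recQ 0; have [r _ or] := recR 0.
have right t : (q <= t)%R -> o (t + Q%:Z)%R = o t.
  move=> qt; have [q' q'_ge oq'] := recQ (absz t).
  apply: (parsing_agree_between (parsing_shift _ po) po oQ _ oq oq'); lia.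
have left t : (t <= r)%R -> o (t + R%:Z)%R = o t.
  move=> tr; have [r' r'_ge or'] := recR (absz t).
  apply: (parsing_agree_between (parsing_shift _ po) po oR _ or' or); lia.
have right_k k t : (q <= t)%R -> o (t + (k * Q)%:Z)%R = o t.
  elim: k => [|k IHk] qt; first by rewrite mul0n GRing.addr0.
  have -> : (t + (k.+1 * Q)%:Z = t + (k * Q)%:Z + Q%:Z)%R by lia.
  by rewrite right ?IHk //; lia.
have left_k k t : (t <= r)%R -> o (t - (k * R)%:Z)%R = o t.
  elim: k => [|k IHk] tr; first by rewrite mul0n GRing.subr0.
  rewrite -IHk // -left; last by lia.
  by congr o; lia.
exists (R * Q) => [|m]; first by rewrite muln_gt0 R_gt0.
(* Two positions far enough for both periods to hold outside. *)
pose u : int := (- (`|m| + `|q| + `|r|)%N%:Z)%R; pose v : int := (- u)%R.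
apply: (parsing_agree_between (parsing_shift _ po) po (label_periodM R oQ)
          (m := (u - (Q * R)%:Z)%R) (m' := v)).
- rewrite /v /u; lia.
- have -> : (u - (Q * R)%:Z + (R * Q)%:Z = u)%R by lia.
  by rewrite left_k // /u; lia.
- by apply: right_k; rewrite /v /u; lia.
- rewrite /v /u; lia.
Qed.

Lemma periodic_agree_left (o o' : biinf nat) Q Q' m0 : 0 < Q -> 0 < Q' ->
  (forall m, o (m + Q%:Z)%R = o m) -> (forall m, o' (m + Q'%:Z)%R = o' m) ->
  (forall m, (m < m0)%R -> o m = o' m) -> o =1 o'.
Proof.
move=> Q_gt0 Q'_gt0 oQ o'Q' agree m.
have back (p : biinf nat) R k t : (forall m, p (m + R%:Z)%R = p m) ->
    p (t - (k * R)%:Z)%R = p t.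
  move=> pR; elim: k t => [|k IHk] t; first by rewrite mul0n GRing.subr0.
  by rewrite -[LHS]pR -[RHS]IHk; congr p; lia.
(* Common period times k: enough to move m to the left of m0. *)
pose k := absz (m - m0 + 1)%R.
rewrite -(back _ _ (k * Q') m oQ) -(back _ _ (k * Q) m o'Q').
rewrite (mulnAC k Q Q').
have le_k : k <= k * Q' * Q by rewrite -mulnA leq_pmulr // muln_gt0 Q'_gt0.
have lt_k : (m - m0 + 1 <= k%:Z)%R by rewrite /k; lia.
by apply: agree; lia.
Qed.

(** * Centered representations as cuttings *)

(** In the point that the centered representation [(x, k)] describes, the image of
    the letter [x t] starts at position [cuts x k t]. *)
Definition cuts (x : biinf A) (k : nat) (t : int) : int :=
  match t with
  | Posz n => ((size (sigma (factor x 0 n)))%:Z - k%:Z)%R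
  | Negz n => (- (size (sigma (factor x (Negz n) n.+1)))%:Z - k%:Z)%R
  end.

Lemma factor1 (T : Type) (y : biinf T) m : factor y m 1 = [:: y m].
Proof. by rewrite /factor /mkseq /= GRing.addr0. Qed.

Lemma sigma_factor_rcons x n :
  sigma (factor x 0%R n.+1) = sigma (factor x 0%R n) ++ word (x n%:Z%R).
Proof. by rewrite -addn1 factorD sigma_morph.2 factor1 GRing.add0r. Qed.

Lemma sigma_factor_cons x n :
  sigma (factor x (- n.+1%:Z)%R n.+1) =
    word (x (Negz n)) ++ sigma (factor x (- n%:Z)%R n).
Proof.
rewrite -[in factor _ _ n.+1]add1n factorD sigma_morph.2 factor1.
by congr (word (x _) ++ sigma (factor x _ _)); lia.
Qed.

Lemma cuts_left x k n :
  cuts x k (- n%:Z)%R = (- (size (sigma (factor x (- n%:Z)%R n)))%:Z - k%:Z)%R.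
Proof. by case: n => [|n] /=; rewrite ?sigma_morph.1. Qed.

Lemma cuts_negz x k n : cuts x k (Negz n) =
  (- (size (word (x (Negz n))) + size (sigma (factor x (- n%:Z)%R n)))%N%:Z - k%:Z)%R.
Proof. by rewrite -size_cat -sigma_factor_cons. Qed.

Lemma cuts0 x k : cuts x k 0 = (- k%:Z)%R.
Proof. by rewrite /= sigma_morph.1 GRing.sub0r. Qed.

Lemma cutsS x k t : cuts x k (t + 1)%R = (cuts x k t + (size (word (x t)))%:Z)%R.
Proof.
case: t => n.
  have -> : (n%:Z + 1 = n.+1%:Z)%R by lia.
  by rewrite /cuts sigma_factor_rcons size_cat; lia.
have -> : (Negz n + 1 = - n%:Z)%R by lia.
by rewrite cuts_left cuts_negz; lia.
Qed.

Lemma cuts_mono x k (t t' : int) : (t < t')%R -> (cuts x k t < cuts x k t')%R.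
Proof.
move=> lt_tt'; pose d := (absz (t' - t)).-1.
have -> : t' = (t + d%:Z + 1)%R by rewrite /d; lia.
elim: d => [|d IHd]; rewrite cutsS.
  by rewrite GRing.addr0; have := word_gt0 (x t); lia.
have -> : (t + d.+1%:Z = t + d%:Z + 1)%R by lia.
by have := word_gt0 (x (t + d%:Z + 1)%R); lia.
Qed.

Lemma cuts_cover x k (m : int) : exists t, (cuts x k t <= m < cuts x k (t + 1))%R.
Proof.
have step t (n : int) : (cuts x k t <= n < cuts x k (t + 1))%R ->
    exists t', (cuts x k t' <= n + 1 < cuts x k (t' + 1))%R.
  move=> t_n; have [lt_n|ge_n] := boolP (n + 1 < cuts x k (t + 1))%R.
    by exists t; lia.
  exists (t + 1)%R; have := @cuts_mono x k (t + 1)%R (t + 1 + 1)%R; lia.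
have step_back t (n : int) : (cuts x k t <= n < cuts x k (t + 1))%R ->
    exists t', (cuts x k t' <= n - 1 < cuts x k (t' + 1))%R.
  move=> t_n; have [le_n|gt_n] := boolP (cuts x k t <= n - 1)%R.
    by exists t; lia.
  exists (t - 1)%R; have -> : (t - 1 + 1 = t)%R by lia.
  have := @cuts_mono x k (t - 1)%R t; lia.
have -> : m = (m + k%:Z - k%:Z)%R by lia.
have cuts01 : (- k%:Z < cuts x k (0 + 1))%R by rewrite -(cuts0 x k); apply: cuts_mono.
case: (m + k%:Z)%R => n.
  elim: n => [|n [t t_n]].
    exists 0%R; rewrite cuts0 GRing.sub0r; rewrite Order.PreorderTheory.lexx.
    exact: cuts01.
  have -> : (n.+1%:Z - k%:Z = n%:Z - k%:Z + 1)%R by lia.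
  exact: step t_n.
have -> : (Negz n - k%:Z = - n%:Z - k%:Z - 1)%R by lia.
elim: n => [|n [t t_n]].
  apply: (step_back 0%R); rewrite cuts0 GRing.oppr0 GRing.sub0r.
  by rewrite Order.PreorderTheory.lexx; exact: cuts01.
have -> : (- n.+1%:Z - k%:Z - 1 = - n%:Z - k%:Z - 1 - 1)%R by lia.
exact: step_back t_n.
Qed.

Lemma cuts_uniq x k (t t' m : int) : (cuts x k t <= m < cuts x k (t + 1))%R ->
  (cuts x k t' <= m < cuts x k (t' + 1))%R -> t = t'.
Proof.
have ge_next (u u' : int) : (u < u')%R -> (cuts x k (u + 1) <= cuts x k u')%R.
  move=> lt_uu'; have [->//|neq] := eqVneq (u + 1)%R u'.
  by apply/Order.POrderTheory.ltW/cuts_mono; lia.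
move=> tm t'm; have [lt|gt|//] := Order.TotalTheory.ltgtP t t'.
  by have := ge_next _ _ lt; lia.
by have := ge_next _ _ gt; lia.
Qed.

Lemma cuts_shift x k t : (cuts x k t = cuts x 0 t - k%:Z)%R.
Proof. by case: t => n /=; lia. Qed.

Lemma cuts_spec x k c : c 0%R = (- k%:Z)%R ->
  (forall t, c (t + 1)%R = (c t + (size (word (x t)))%:Z)%R) -> c =1 cuts x k.
Proof.
move=> c0 cS; have right n : c n%:Z%R = cuts x k n%:Z%R.
  elim: n => [|n IHn]; first by rewrite cuts0.
  have -> : (n.+1%:Z = n%:Z + 1)%R by lia.
  by rewrite cS cutsS IHn.
have left n : c (- n%:Z)%R = cuts x k (- n%:Z)%R.
  elim: n => [|n IHn]; first by rewrite GRing.oppr0 cuts0.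
  have := cS (- n.+1%:Z)%R; have := cutsS x k (- n.+1%:Z)%R.
  have -> : (- n.+1%:Z + 1 = - n%:Z)%R by lia.
  by lia.
by case=> n; [exact: right|rewrite NegzE; exact: left].
Qed.

Lemma size_sigma w : size w <= size (sigma w).
Proof.
elim: w => // a w IHw; rewrite sigma_cons size_cat /=.
by have := word_gt0 a; lia.
Qed.

(** The conditions on the left and right halves of the image become a single
    local one, in which no position plays a special part. *)
Lemma is_image_cuts x z : is_image sigma x z <->
  forall t, factor z (cuts x 0 t) (size (word (x t))) = word (x t).
Proof.
have pos n : cuts x 0 n%:Z%R = Posz (size (sigma (factor x 0%R n))) by rewrite /=; lia.
split=> [[right left _ _] [n|n]|img].
- have := right n.+1; rewrite sigma_factor_rcons size_cat factorD -right.
  move/eqP; rewrite eqseq_cat // eqxx => /eqP eq_w.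
  by rewrite [RHS]eq_w; congr factor; rewrite pos; lia.
- have := left n.+1; rewrite sigma_factor_cons size_cat factorD.
  move/eqP; rewrite eqseq_cat ?size_factor // => /andP[/eqP eq_w _].
  rewrite [RHS]eq_w; congr factor; rewrite cuts_negz; lia.
split.
- elim=> [|n IHn]; first by rewrite sigma_morph.1.
  rewrite sigma_factor_rcons size_cat factorD -IHn; congr (_ ++ _).
  by rewrite -{1}(img n%:Z%R); congr factor; rewrite pos; lia.
- elim=> [|n IHn]; first by rewrite sigma_morph.1.
  rewrite sigma_factor_cons size_cat factorD; congr (_ ++ _).
    rewrite -{1}(img (Negz n)); congr factor.
    by rewrite cuts_negz; lia.
  by rewrite [LHS]IHn; congr factor; lia.
- by move=> N; exists N; rewrite -{1}(size_factor x 0%R N) size_sigma.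
- by move=> N; exists N; rewrite -{1}(size_factor x (- N%:Z)%R N) size_sigma.
Qed.

Lemma iter_shift (T : Type) (y : biinf T) k m : iter k (@shift T) y m = y (m + k%:Z)%R.
Proof.
elim: k m => [|k IHk] m; first by rewrite GRing.addr0.
by rewrite iterS /shift IHk; congr y; lia.
Qed.

Lemma eq_factor (T : Type) (y y' : biinf T) m m' l :
  (forall i, i < l -> y (m + i%:Z)%R = y' (m' + i%:Z)%R) ->
  factor y m l = factor y' m' l.
Proof. by move=> eq_y; apply/eq_in_map => i; rewrite mem_iota => /= /eq_y. Qed.

Lemma centered_representation_cuts y x k : centered_representation sigma y x k <->
  k < size (word (x 0%R)) /\
  forall t, factor y (cuts x k t) (size (word (x t))) = word (x t).
Proof.
split=> [[[z [img yz]] kx]|[kx img]]; split=> //.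
  move/is_image_cuts in img; move=> t; rewrite -[RHS]img; apply: eq_factor => i _.
  by rewrite yz iter_shift (cuts_shift x k); congr z; lia.
exists (fun m => y (m - k%:Z)%R); split.
  apply/is_image_cuts => t; rewrite -[RHS]img; apply: eq_factor => i _.
  by rewrite (cuts_shift x k); congr y; lia.
by move=> m; rewrite iter_shift; congr y; lia.
Qed.

Definition represents (o : biinf nat) (x : biinf A) (k : nat) : Prop :=
  forall t i, i < size (word (x t)) -> o (cuts x k t + i%:Z)%R = occ (x t) i.

Lemma parsing_of_representation y x k : centered_representation sigma y x k ->
  exists o, [/\ parsing o, parses o y & represents o x k].
Proof.
move=> /centered_representation_cuts[kx img].
pose cut_of (m : int) : int := xchoose (cuts_cover x k m).
have cut_ofP (m : int) : (cuts x k (cut_of m) <= m < cuts x k (cut_of m + 1))%R.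
  exact: xchooseP (cuts_cover x k m).
pose o (m : int) := occ (x (cut_of m)) (absz (m - cuts x k (cut_of m))%R).
have repr : represents o x k.
  move=> t i ti; rewrite /o.
  have -> : cut_of (cuts x k t + i%:Z)%R = t.
    by apply: cuts_uniq (cut_ofP _) _; rewrite cutsS; lia.
  by congr occ; lia.
have locate (m : int) : exists t i, i < size (word (x t)) /\ m = (cuts x k t + i%:Z)%R.
  have := cut_ofP m; rewrite cutsS; move: (cut_of m) => t mt.
  by exists t, (absz (m - cuts x k t)%R); lia.
exists o; split=> // m; have [t [i [ti ->]]] := locate m.
- rewrite repr //; split; first exact: occ_lt.
  rewrite node_occS //; case: eqP => [last_i|/eqP nlast].
    have -> : (cuts x k t + i%:Z + 1 = cuts x k (t + 1) + 0%:Z)%R.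
      by rewrite cutsS; lia.
    by rewrite repr ?word_gt0 // node_occ // word_gt0.
  have ti1 : i.+1 < size (word (x t)) by rewrite ltn_neqAle nlast.
  have -> : (cuts x k t + i%:Z + 1 = cuts x k t + i.+1%:Z)%R by lia.
  by rewrite repr // node_occ // occS.
- rewrite repr // (letter_occ (y 0%R)) //.
  by rewrite -(nth_factor (y 0%R) y (cuts x k t) ti) img.
Qed.

(** The letters of [x] are read off the parsing by jumping over whole words, to the
    right and to the left, from the boundary that precedes position 0. *)
Lemma representation_of_parsing o y : parsing o -> parses o y ->
  exists x k, centered_representation sigma y x k /\ represents o x k.
Proof.
move=> po oy.
have ex_occ m : exists ai : A * nat, (ai.2 < size (word ai.1)) && (o m == occ ai.1 ai.2).
  have [a [i [ia ->]]] := parsing_occ m po.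
  by exists (a, i); rewrite ia eqxx.
pose a m := (xchoose (ex_occ m)).1; pose i m := (xchoose (ex_occ m)).2.
have oE m : i m < size (word (a m)) /\ o m = occ (a m) (i m).
  by have /andP[? /eqP] := xchooseP (ex_occ m).
have ai_uniq m a' i' : i' < size (word a') -> o m = occ a' i' -> a m = a' /\ i m = i'.
  by have [im ->] := oE m; exact: occ_inj.
have next_start m : i m = 0 -> i (m + (size (word (a m)))%:Z)%R = 0.
  move=> im0; have [] := oE m; rewrite im0; set s := size _ => s_gt0 om.
  have om_s : o (m + s.-1%:Z)%R = occ (a m) s.-1.
    by rewrite -[s.-1 in RHS]add0n; apply: parsing_forward => //; rewrite -/s; lia.
  have := parsing_last po om_s (prednK s_gt0).
  have -> : (m + s.-1%:Z + 1 = m + s%:Z)%R by lia.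
  by have [ims ->] := oE (m + s%:Z)%R; rewrite node_occ //; case: eqP => // _;
    case: (i _) => // ?; rewrite occS.
have prev_start m : i m = 0 ->
    let m' := (m - (size (word (a (m - 1))))%:Z)%R in i m' = 0 /\ a m' = a (m - 1)%R.
  move=> im0 m'; have [im1 om1] := oE (m - 1)%R.
  have last_i : (i (m - 1)%R).+1 = size (word (a (m - 1)%R)).
    apply/eqP; rewrite eqn_leq im1 /= leqNgt; apply/negP => lt_i.
    have := parsing_next po om1 lt_i.
    have -> : (m - 1 + 1 = m)%R by lia.
    by move=> /(ai_uniq _ _ _ lt_i)[_]; rewrite im0.
  have := parsing_backward po om1 im1 (leqnn _); rewrite subnn.
  have -> : (m - 1 - (i (m - 1))%:Z = m')%R by rewrite /m' -last_i; lia.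
  by move=> /(ai_uniq _ _ _ (word_gt0 _))[-> ->].
(* From a boundary to the next one, and to the previous one. *)
pose next m : int := (m + (size (word (a m)))%:Z)%R.
pose prev m : int := (m - (size (word (a (m - 1))))%:Z)%R.
pose k := i 0%R.
pose c (t : int) : int := match t with
  | Posz n => iter n next (- k%:Z)%R | Negz n => iter n.+1 prev (- k%:Z)%R end.
have start0 : i (- k%:Z)%R = 0.
  have [i0 o0] := oE 0%R; have := parsing_backward po o0 i0 (leqnn _).
  by rewrite subnn GRing.sub0r => /(ai_uniq _ _ _ (word_gt0 _))[].
have start t : i (c t) = 0.
  case: t => n; elim: n => [|n IHn] //; try by apply: next_start.
    exact: (prev_start _ start0).1.
  exact: (prev_start _ IHn).1.
have cS t : c (t + 1)%R = (c t + (size (word (a (c t))))%:Z)%R.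
  case: t => n; first by have -> : (n%:Z + 1 = n.+1%:Z)%R by lia.
  have cN : c (Negz n) = prev (c (Negz n + 1)%R).
    have -> : (Negz n + 1 = - n%:Z)%R by lia.
    by case: (n).
  have := prev_start _ (start (Negz n + 1)%R); rewrite -/(prev _) -cN => -[_ ->].
  by rewrite cN /prev GRing.subrK.
pose x t := a (c t).
have c0 : c 0%R = (- k%:Z)%R by [].
have c_cuts := cuts_spec c0 (cS : forall t, _ = (_ + (size (word (x t)))%:Z)%R).
have repr : represents o x k.
  move=> t j tj; rewrite -c_cuts -[j in RHS]add0n.
  by apply: parsing_forward; rewrite ?(oE (c t)).2 ?start.
exists x, k; split=> //; apply/centered_representation_cuts; split.
  have [i0 o0] := oE 0%R; rewrite /x c0.
  have := parsing_backward po o0 i0 (leqnn _).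
  by rewrite subnn GRing.sub0r => /(ai_uniq _ _ _ (word_gt0 _))[-> _].
move=> t; apply: (@eq_from_nth _ (y 0%R)) => [|j]; rewrite size_factor // => tj.
rewrite nth_factor //; apply/enum_rank_inj/val_inj => /=.
by rewrite -oy repr // (letter_occ (y 0%R)).
Qed.

Lemma represents_eq o x x' k k' : k < size (word (x 0%R)) -> k' < size (word (x' 0%R)) ->
  represents o x k -> represents o x' k' -> x =1 x' /\ k = k'.
Proof.
move=> kx kx' repr repr'.
have [eq_x0 eq_k] : x 0%R = x' 0%R /\ k = k'.
  apply: occ_inj => //; rewrite -repr // -repr' // !cuts0.
  by congr o; lia.
split=> //; subst k'.
have cuts_right n : cuts x k n%:Z%R = cuts x' k n%:Z%R /\ x n%:Z%R = x' n%:Z%R.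
  elim: n => [|n [eq_c eq_x]]; first by rewrite !cuts0.
  have eq_c1 : cuts x k n.+1%:Z%R = cuts x' k n.+1%:Z%R.
    have -> : (n.+1%:Z = n%:Z + 1)%R by lia.
    by rewrite !cutsS eq_c eq_x.
  split=> //; have := repr n.+1%:Z%R 0 (word_gt0 _).
  rewrite eq_c1 repr' ?word_gt0 // => /(occ_inj (word_gt0 _) (word_gt0 _))[] //.
have cuts_left n : cuts x k (- n%:Z)%R = cuts x' k (- n%:Z)%R /\ x (- n%:Z)%R = x' (-
  n%:Z)%R.
  elim: n => [|n [eq_c eq_x]]; first by rewrite GRing.oppr0 !cuts0.
  set t := (- n.+1%:Z)%R; have et : (- n%:Z = t + 1)%R by rewrite /t; lia.
  have lastP u l : represents o u l -> o (cuts u l (t + 1) - 1)%R = occ (u t) (size (word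
    (u t))).-1.
    move=> ru; rewrite -ru ?cutsS; last by have := word_gt0 (u t); lia.
    by congr o; have := word_gt0 (u t); lia.
  have := lastP _ _ repr; rewrite -et eq_c et (lastP _ _ repr').
  have pred_lt b : (size (word b)).-1 < size (word b) by have := word_gt0 b; lia.
  move=> /(occ_inj (pred_lt _) (pred_lt _))[eq_xt _]; split=> //.
  have := cutsS x k t; have := cutsS x' k t.
  by rewrite -et eq_c eq_xt; lia.
by case=> n; [have [] := cuts_right n|rewrite NegzE; have [] := cuts_left n.+1].
Qed.

Lemma eq_represents o o' x x' k : x =1 x' -> represents o x k -> represents o' x' k -> o
  =1 o'.
Proof.
move=> eq_x repr repr' m.
have eq_cuts : cuts x k =1 cuts x' k.
  by apply: cuts_spec => [|t]; rewrite ?cuts0 ?cutsS ?eq_x.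
have [t mt] := cuts_cover x k m; rewrite cutsS in mt.
have -> : m = (cuts x k t + (absz (m - cuts x k t))%:Z)%R by lia.
by rewrite repr ?eq_cuts ?repr' -?eq_cuts -?eq_x //; lia.
Qed.

(** * The graph of pairs decides recognizability *)

Definition first_size : nat := head 0 (shape words).

Local Notation pair_edge := (pair_edge (size text) first_size letter).
Local Notation pair_node := (pair_node (size text) node).
Local Notation edges := (edges (size text) first_size letter).
Local Notation essential := (essential (size text) first_size letter node).
Local Notation inner_edge := (inner_edge (size text) first_size letter node).
Local Notation deterministic := (deterministic (size text) first_size letter node).

Lemma pair_node_inj d d' e e' : pair_edge e -> pair_edge e' -> d <= 1 -> d' <= 1 ->
  pair_node d e = pair_node d' e' ->
  node (e.1 + d) = node (e'.1 + d') /\ node (e.2 + d) = node (e'.2 + d').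
Proof.
move=> /and4P[e1 e2 _ _] /and4P[e1' e2' _ _] d1 d1' eq_nodes.
have n_gt0 : 0 < size text by lia.
have lt_node k c : k < size text -> c <= 1 -> node (k + c) < size text.
  by move=> kn c1; apply: node_lt => //; lia.
have := congr1 (modn^~ (size text)) eq_nodes;
  have := congr1 (divn^~ (size text)) eq_nodes.
by rewrite /= /pair_node !divnMDl // !modnMDl !divn_small ?modn_small ?addn0 ?lt_node.
Qed.

Lemma first_wordP : 0 < size text ->
  exists a, first_size = size (word a) /\ forall i, occ a i = i.
Proof.
move=> /occP[a0 [i0 [_ _]]].
have A_gt0 : 0 < #|A| by apply/card_gt0P; exists a0.
exists (enum_val (Ordinal A_gt0)); split=> [|i].
  by rewrite -nth_shape enum_valK /first_size /= nth0.
by rewrite /occ enum_valK /flatten_index /= take0.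
Qed.

Lemma first_edge i : i < first_size -> pair_edge (i, i).
Proof.
move=> lt_i; have n_gt0 : 0 < size text.
  rewrite lt0n; apply/negP => /eqP n0; move: lt_i n0; rewrite /first_size size_text.
  by case: (shape words) => //= m sh; lia.
have [a [ea oa]] := first_wordP n_gt0.
have := @occ_lt a i; rewrite -ea oa => /(_ lt_i) lt_in.
by rewrite /pair_edge /= lt_in lt_i eqxx orbT.
Qed.

Lemma first_node d i : i + d <= first_size ->
  node (i + d) = if (i + d == 0) || (i + d == first_size) then 0 else i + d.
Proof.
have [->|id_gt0] := posnP (i + d); first by rewrite /node /word_node; case: ifP.
rewrite /= => le_id; have first_gt0 : 0 < first_size by lia.
have := first_edge first_gt0 => /and4P[n_gt0 _ _ _].
have [a [ea oa]] := first_wordP (leq_ltn_trans (leq0n _) n_gt0).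
have := @node_occS a (i + d).-1; rewrite -occS prednK // oa -ea.
by apply; lia.
Qed.

Lemma node_eq k l : k != l -> node k = node l -> node k = 0.
Proof.
move=> neq_kl eq_n; apply/eqP; apply: contraNT neq_kl => nk.
by rewrite -(node_id nk) eq_n node_id -?eq_n.
Qed.

Section DeterministicGraph.

Variable E : pred nat.
Hypothesis ess : essential E.
Hypothesis det : deterministic E.

(** Determinism says that inner edges have distinct sources.  The sources and the
    targets of the inner edges are the same nodes, namely those of [E]. *)
Lemma inner_edge_target_inj e e' : inner_edge E e -> inner_edge E e' ->
  pair_node 1 e = pair_node 1 e' -> e = e'.
Proof.
pose inner := [seq e <- edges | inner_edge E e].
have mem_inner u : (u \in inner) = inner_edge E u.
  by rewrite mem_filter mem_edges; apply/andb_idr => /and3P[].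
rewrite -!mem_inner; apply: (same_image_inj (f := pair_node 0)).
- exact/filter_uniq/edges_uniq.
- by move=> u u'; rewrite !mem_inner; exact: det.
move=> v; apply/mapP/mapP => -[u]; rewrite mem_inner => /and3P[uedge Eu0 Eu1] ->.
  have [u' [u'edge u'E Eu']] := essential_pred ess Eu0.
  by exists u' => //; rewrite mem_inner /inner_edge u'edge Eu' u'E Eu0.
have [u' [u'edge u'E Eu']] := essential_succ ess Eu1.
by exists u' => //; rewrite mem_inner /inner_edge u'edge Eu' u'E Eu1.
Qed.

Variables (o o' : biinf nat).
Hypotheses (po : parsing o) (po' : parsing o').
Hypothesis eq_letter : forall m, letter (o m) = letter (o' m).

Let at_ m := (o m, o' m).

Lemma split_edge m : o m != o' m -> pair_edge (at_ m).
Proof. by move=> neq; rewrite /pair_edge /= (po m).1 (po' m).1 eq_letter eqxx neq. Qed.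

Lemma split_target m : pair_node 1 (at_ m) = pair_node 0 (at_ (m + 1)%R).
Proof. by rewrite /pair_node /= !addn1 !addn0 (po m).2 (po' m).2. Qed.

(** A node other than 0 belongs to a single occurrence, so that two parsings can
    only meet at a boundary. *)
Lemma merge_next m : o m != o' m -> o (m + 1)%R = o' (m + 1)%R ->
  pair_node 1 (at_ m) = 0.
Proof.
move=> neq eq1; have := @node_eq (o m).+1 (o' m).+1.
rewrite /pair_node /= !addn1 (po m).2 (po' m).2 eq1 eqSS => /(_ neq erefl) ->.
by rewrite mul0n.
Qed.

Lemma merge_prev m : o (m + 1)%R != o' (m + 1)%R -> o m = o' m ->
  pair_node 0 (at_ (m + 1)%R) = 0.
Proof.
move=> neq eq1; have := node_eq neq.
by rewrite /pair_node /= !addn0 -(po m).2 -(po' m).2 eq1 => /(_ erefl) ->.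
Qed.

Lemma first_size_gt0 : 0 < first_size.
Proof.
have n_gt0 : 0 < size text by have := (po 0%R).1; lia.
by have [a [-> _]] := first_wordP n_gt0; exact: word_gt0.
Qed.

Lemma first_node_source : pair_node 0 (0, 0) = 0.
Proof. by rewrite /pair_node /= first_node. Qed.

Lemma first_node_target : pair_node 1 (first_size.-1, first_size.-1) = 0.
Proof.
by rewrite /pair_node /= first_node addn1 prednK ?first_size_gt0 // eqxx orbT.
Qed.

(** The nodes that the parsings visit while they differ and the nodes of the first
    word form a set in which every node has a successor and a predecessor:
    wherever the parsings meet, the path can be continued round the first word. *)
Lemma parsing_nodes_essential : (forall m, o m != o' m -> E (pair_node 0 (at_ m))) /\
  (forall i, i < first_size -> E (pair_node 0 (i, i))).
Proof.
pose T v := (exists2 m, o m != o' m & v = pair_node 0 (at_ m)) \/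
  (exists2 i, i < first_size & v = pair_node 0 (i, i)).
suff TE v : T v -> E v by split=> [m neq|i lt_i]; apply: TE; [left; exists m|right;
  exists i].
apply: (essential_max ess) => {}v [[m neq ->]|[i lt_i ->]].
- exists (at_ m); split=> //; first exact: split_edge.
  have [eq1|neq1] := eqVneq (o (m + 1)%R) (o' (m + 1)%R); last first.
    by left; exists (m + 1)%R => //; exact: split_target.
  right; exists 0; first exact: first_size_gt0.
  by rewrite merge_next // first_node_source.
- exists (i, i); split=> //; first exact: first_edge.
  right; have [lt_i1|ge_i1] := ltnP i.+1 first_size.
    by exists i.+1 => //; rewrite /pair_node /= addn1 addn0.
  exists 0; first exact: first_size_gt0.
  have -> : i = first_size.-1 by lia.
  by rewrite first_node_target first_node_source.
- have em : (m - 1 + 1 = m)%R by lia.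
  have [eq1|neq1] := eqVneq (o (m - 1)%R) (o' (m - 1)%R); last first.
    exists (at_ (m - 1)%R); split; first exact: split_edge.
      by rewrite split_target em.
    by left; exists (m - 1)%R.
  exists (first_size.-1, first_size.-1); split.
  + by apply: first_edge; rewrite prednK // first_size_gt0.
  + by rewrite first_node_target -em merge_prev // em.
  + by right; exists first_size.-1 => //; rewrite prednK // first_size_gt0.
- case: i lt_i => [|i] lt_i.
    exists (first_size.-1, first_size.-1); split.
    + by apply: first_edge; rewrite prednK // first_size_gt0.
    + by rewrite first_node_target first_node_source.
    + by right; exists first_size.-1 => //; rewrite prednK // first_size_gt0.
  exists (i, i); split; first by apply: first_edge; exact: ltnW.
    by rewrite /pair_node /= addn1 addn0.
  by right; exists i => //; exact: ltnW.
Qed.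

Lemma split_inner m : o m != o' m -> inner_edge E (at_ m).
Proof.
move=> neq; have [Esplit Efirst] := parsing_nodes_essential.
rewrite /inner_edge split_edge // Esplit //=.
have [eq1|neq1] := eqVneq (o (m + 1)%R) (o' (m + 1)%R).
  by rewrite merge_next // -first_node_source Efirst // first_size_gt0.
by rewrite split_target Esplit.
Qed.

Lemma first_inner i : i < first_size -> inner_edge E (i, i).
Proof.
move=> lt_i; have [_ Efirst] := parsing_nodes_essential.
rewrite /inner_edge first_edge // Efirst //=.
have [lt_i1|ge_i1] := ltnP i.+1 first_size.
  by have := Efirst _ lt_i1; rewrite /pair_node /= addn1 addn0.
have -> : i = first_size.-1 by lia.
by rewrite first_node_target -first_node_source Efirst // first_size_gt0.
Qed.

(** A path that meets the diagonal at (0, 0) shares this node with the cycle of the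
    first word.  Inside [E] it is then part of this cycle, in both directions. *)
Lemma split_everywhere m : o m != o' m -> forall t, o t != o' t.
Proof.
move=> neq.
have next t : o t != o' t -> o (t + 1)%R != o' (t + 1)%R.
  move=> neq_t; apply/negP => /eqP eq1.
  have last_inner : inner_edge E (first_size.-1, first_size.-1).
    by apply: first_inner; rewrite prednK // first_size_gt0.
  have := inner_edge_target_inj (split_inner neq_t) last_inner.
  rewrite merge_next // first_node_target => /(_ erefl)[eq_o eq_o'].
  by rewrite eq_o eq_o' eqxx in neq_t.
have prev t : o (t + 1)%R != o' (t + 1)%R -> o t != o' t.
  move=> neq_t; apply/negP => /eqP eq1.
  have := det (split_inner neq_t) (first_inner first_size_gt0).
  rewrite merge_prev // first_node_source => /(_ erefl)[eq_o eq_o'].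
  by rewrite eq_o eq_o' eqxx in neq_t.
have right k : o (m + k%:Z)%R != o' (m + k%:Z)%R.
  elim: k => [|k IHk]; first by rewrite GRing.addr0.
  have -> : (m + k.+1%:Z = m + k%:Z + 1)%R by lia.
  exact: next.
have left k : o (m - k%:Z)%R != o' (m - k%:Z)%R.
  elim: k => [|k IHk]; first by rewrite GRing.subr0.
  apply: prev; have -> : (m - k.+1%:Z + 1 = m - k%:Z)%R by lia.
  exact: IHk.
move=> t; have [le_mt|lt_tm] := boolP (m <= t)%R.
  by have -> : t = (m + (absz (t - m))%:Z)%R by lia.
by have -> : t = (m - (absz (t - m))%:Z)%R by lia.
Qed.

(** Each inner edge determines the next one and the previous one, so that an edge
    that is met twice makes the whole path periodic. *)
Lemma split_periodic m : o m != o' m ->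
  exists2 P, 0 < P & forall t, o (t + P%:Z)%R = o t.
Proof.
move=> neq; have split_all := split_everywhere neq.
have [i [j [lt_ij eq_ij]]] : exists i j, i < j /\ at_ i%:Z%R = at_ j%:Z%R.
  pose f (i : 'I_(size edges).+1) := index (at_ i%:Z%R) edges.
  have f_lt i : f i < size edges by rewrite index_mem mem_edges split_edge.
  pose g i : 'I_(size edges) := Ordinal (f_lt i).
  have /injectivePn[i [j neq_ij /(congr1 val)/= gij]] : ~~ injectiveb g.
    apply/negP => /injectiveP/leq_card; rewrite !card_ord.
    by rewrite ltnn.
  have eq_ij : at_ i%:Z%R = at_ j%:Z%R.
    rewrite -[LHS](nth_index (0, 0) (s := edges)) ?mem_edges ?split_edge //.
    by rewrite -/(f i) gij nth_index // mem_edges split_edge.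
  have [lt_ij|lt_ji|/val_inj eqij] := ltngtP i j.
  - by exists i, j.
  - by exists j, i.
  - by rewrite eqij eqxx in neq_ij.
exists (j - i); first by rewrite subn_gt0.
have inner t := split_inner (split_all t).
suff eq_at t : at_ (t + (j - i)%:Z)%R = at_ t by move=> t; case: (eq_at t).
have right k : at_ (i%:Z + k%:Z + (j - i)%:Z)%R = at_ (i%:Z + k%:Z)%R.
  elim: k => [|k IHk].
    by rewrite GRing.addr0 eq_ij; congr at_; lia.
  have -> : (i%:Z + k.+1%:Z + (j - i)%:Z = i%:Z + k%:Z + (j - i)%:Z + 1)%R by lia.
  have -> : (i%:Z + k.+1%:Z = i%:Z + k%:Z + 1)%R by lia.
  by apply: det => //; rewrite -!split_target IHk.
have left k : at_ (i%:Z - k%:Z + (j - i)%:Z)%R = at_ (i%:Z - k%:Z)%R.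
  elim: k => [|k IHk].
    by rewrite GRing.subr0 eq_ij; congr at_; lia.
  apply: inner_edge_target_inj => //; rewrite !split_target.
  have -> : (i%:Z - k.+1%:Z + (j - i)%:Z + 1 = i%:Z - k%:Z + (j - i)%:Z)%R by lia.
  have -> : (i%:Z - k.+1%:Z + 1 = i%:Z - k%:Z)%R by lia.
  by rewrite IHk.
have [le_it|lt_ti] := boolP (i%:Z <= t)%R.
  by have -> : t = (i%:Z + (absz (t - i%:Z))%:Z)%R by lia.
by have -> : t = (i%:Z - (absz (t - i%:Z))%:Z)%R by lia.
Qed.

End DeterministicGraph.

Lemma deterministic_recognizable E : essential E -> deterministic E ->
  recognizable_for_aperiodic_points sigma.
Proof.
move=> ess det y y_aper x x' k k' rep rep'.
have [o [po oy repr]] := parsing_of_representation rep.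
have [o' [po' oy' repr']] := parsing_of_representation rep'.
have [kx _] := centered_representation_cuts y x k; have [{}kx _] := kx rep.
have [kx' _] := centered_representation_cuts y x' k'; have [{}kx' _] := kx' rep'.
suff eq_o : o =1 o'.
  apply: (represents_eq kx kx' repr) => t i ti.
  by rewrite eq_o repr'.
move=> m; apply/eqP/negPn/negP => neq.
have eq_l t : letter (o t) = letter (o' t) by rewrite oy oy'.
have [P P_gt0 oP] := split_periodic ess det po po' eq_l neq.
apply: (y_aper P P_gt0) => t; rewrite iter_shift.
by apply/enum_rank_inj/val_inj => /=; rewrite -!oy oP.
Qed.

Section RecognizableGraph.

Variable E : pred nat.
Hypothesis ess : essential E.
Hypothesis recog : recognizable_for_aperiodic_points sigma.

Definition inner_path (p : int -> nat * nat) : Prop :=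
  forall m, inner_edge E (p m) /\ pair_node 1 (p m) = pair_node 0 (p (m + 1)%R).

Lemma parsing_label o : parsing o -> exists y, parses o y.
Proof.
move=> po; have [a [i [ia o0]]] := parsing_occ 0%R po.
have [b0 _] : exists b : B, b \in word a.
  by case: (word a) (word_gt0 a) => // b s _; exists b; rewrite mem_head.
exists (fun m => nth b0 text (o m)) => m.
by rewrite /letter (nth_map b0) // (po m).1.
Qed.

Lemma first_word_periodic o : parsing o -> (forall m, o m < first_size) ->
  exists2 P, 0 < P & label_period o P.
Proof.
move=> po o_first; exists first_size => [|m]; first by have := o_first 0%R; lia.
congr letter; suff oS k : o (m + k%:Z)%R = (o m + k) %% first_size.
  by rewrite oS modnDr modn_small.
elim: k => [|k IHk]; first by rewrite GRing.addr0 addn0 modn_small.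
have -> : (m + k.+1%:Z = m + k%:Z + 1)%R by lia.
have := (po (m + k%:Z)%R).2; set t := (m + k%:Z)%R => nodeE.
have t1 := @first_node 0 (o (t + 1)%R); rewrite !addn0 in t1.
have t0 := @first_node 1 (o t); rewrite !addn1 in t0.
have lt_t := o_first t; have lt_t1 := o_first (t + 1)%R.
rewrite t0 // t1 ?(ltnW lt_t1) //= in nodeE.
rewrite addnS -(addn1 (_ + _)) -modnDml -IHk -/t.
rewrite addn1; move: nodeE; have [eq_t|neq_t] := eqVneq (o t).+1 first_size.
  by rewrite eq_t modnn (ltn_eqF lt_t1) orbF; case: eqP.
rewrite modn_small; last by rewrite ltn_neqAle neq_t.
by rewrite (ltn_eqF lt_t1) orbF; case: eqP => [->|_ ->].
Qed.

(** If the label of the path is aperiodic, recognizability identifies its two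
    parsings.  The path is then diagonal, hence stays in the first word, and its
    label is periodic after all.  So [parsing_periodic] applies in any case. *)
Lemma inner_path_periodic p : inner_path p -> exists Q Q',
  [/\ 0 < Q, 0 < Q', forall m, (p (m + Q%:Z)%R).1 = (p m).1
    & forall m, (p (m + Q'%:Z)%R).2 = (p m).2].
Proof.
move=> pp; pose o m := (p m).1; pose o' m := (p m).2.
have p_edge m : pair_edge (p m) by have [/and3P[]] := pp m.
have po_po' : parsing o /\ parsing o'.
  by split=> m; have /and4P[lt_o lt_o' _ _] := p_edge m; split=> //;
     have [] := pair_node_inj (p_edge m) (p_edge (m + 1)%R) (leqnn _) (leq0n _) (pp m).2;
     rewrite !addn1 !addn0.
have [po po'] := po_po'.
have eq_l m : letter (o m) = letter (o' m) by have /and4P[_ _ /eqP] := p_edge m.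
have [P P_gt0 oP] : exists2 P, 0 < P & label_period o P.
  have [y oy] := parsing_label po.
  have [y_aper|y_per] := classic (aperiodic y).
    have [x [k [rep repr]]] := representation_of_parsing po oy.
    have o'y : parses o' y by move=> m; rewrite -eq_l.
    have [x' [k' [rep' repr']]] := representation_of_parsing po' o'y.
    have [eq_x eq_k] := recog y_aper rep rep'; rewrite -eq_k in repr'.
    have eq_o := eq_represents eq_x repr repr'.
    apply: first_word_periodic => // m; have /and4P[_ _ _] := p_edge m.
    by rewrite -/(o m) -/(o' m) eq_o eqxx.
  apply: NNPP => no_period; apply: y_per => P P_gt0 yP; apply: no_period.
  by exists P => // m; rewrite !oy -[y m]yP iter_shift.
have o'P : label_period o' P by move=> m; rewrite -!eq_l oP.
have [Q Q_gt0 oQ] := parsing_periodic po P_gt0 oP.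
have [Q' Q'_gt0 oQ'] := parsing_periodic po' P_gt0 o'P.
by exists Q, Q'.
Qed.

Definition next_edge (e : nat * nat) : nat * nat :=
  nth e edges (find (fun e' => inner_edge E e' && (pair_node 1 e == pair_node 0 e'))
    edges).

Definition prev_edge (v : nat) : nat * nat :=
  nth (0, 0) edges (find (fun e' => inner_edge E e' && (pair_node 1 e' == v)) edges).

Lemma next_edgeP e : inner_edge E e ->
  inner_edge E (next_edge e) /\ pair_node 1 e = pair_node 0 (next_edge e).
Proof.
move=> /and3P[_ _ E1]; have [e' [e'edge e'E Ee']] := essential_succ ess E1.
have: has (fun e' => inner_edge E e' && (pair_node 1 e == pair_node 0 e')) edges.
  by apply/hasP; exists e'; rewrite ?mem_edges // /inner_edge e'edge e'E E1 Ee' eqxx.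
by move=> /(nth_find e)/andP[? /eqP].
Qed.

Lemma prev_edgeP v : E v -> inner_edge E (prev_edge v) /\ pair_node 1 (prev_edge v) = v.
Proof.
move=> Ev; have [e' [e'edge e'E Ee']] := essential_pred ess Ev.
have: has (fun e' => inner_edge E e' && (pair_node 1 e' == v)) edges.
  by apply/hasP; exists e'; rewrite ?mem_edges // /inner_edge e'edge e'E Ev Ee' eqxx.
by move=> /(nth_find (0, 0))/andP[? /eqP].
Qed.

Definition path_through (e : nat * nat) (m : int) : nat * nat :=
  match m with
  | Posz n => iter n next_edge e
  | Negz n => iter n (prev_edge \o pair_node 0) (prev_edge (pair_node 0 e))
  end.

Lemma path_throughP e : inner_edge E e -> inner_path (path_through e).
Proof.
move=> inner_e.
have inner_src u : inner_edge E u -> E (pair_node 0 u) by case/and3P.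
have inner m : inner_edge E (path_through e m).
  case: m; elim=> [|n IHn] //=.
  - exact: (next_edgeP IHn).1.
  - exact: (prev_edgeP (inner_src _ inner_e)).1.
  - exact: (prev_edgeP (inner_src _ IHn)).1.
move=> m; split=> //; case: m => [n|[|n]].
- have -> : (n%:Z + 1 = n.+1%:Z)%R by lia.
  exact: (next_edgeP (inner n%:Z%R)).2.
- exact: (prev_edgeP (inner_src _ inner_e)).2.
- have -> : (Negz n.+1 + 1 = Negz n)%R by lia.
  exact: (prev_edgeP (inner_src _ (inner (Negz n)))).2.
Qed.

(** The two edges are extended to the left by the same path, since this extension
    only depends on their source. *)
Lemma recognizable_deterministic : deterministic E.
Proof.
move=> e e' inner_e inner_e' eq_src.
have [Q1 [Q2 [Q1_gt0 Q2_gt0 p1 p2]]] := inner_path_periodic (path_throughP inner_e).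
have [Q1' [Q2' [Q1'_gt0 Q2'_gt0 p1' p2']]] := inner_path_periodic (path_throughP
  inner_e').
have agree m : (m < 0)%R -> path_through e m = path_through e' m.
  by case: m => // n _ /=; rewrite eq_src.
have eq1 := periodic_agree_left (m0 := 0%R) Q1_gt0 Q1'_gt0 p1 p1' _ 0%R.
have eq2 := periodic_agree_left (m0 := 0%R) Q2_gt0 Q2'_gt0 p2 p2' _ 0%R.
apply/eqP; rewrite [e]surjective_pairing [e']surjective_pairing xpair_eqE.
by rewrite -[e]/(path_through e 0%R) -[e']/(path_through e' 0%R) eq1 ?eq2 ?eqxx // => m
  /agree ->.
Qed.

End RecognizableGraph.

End Occurrences.

(** * Programs with a time budget *)

Notation memory := Defs.mem.

Lemma run_add W u v c : run W (u + v) c = obind (run W v) (run W u c).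
Proof.
rewrite /run addnC iterD; case: (iter u _ _) => //=.
by elim: v => //= v ->.
Qed.

Lemma run1 W c : run W 1 c = step W c.
Proof. by []. Qed.

Lemma run_halted W t s : run W t ([::], s) = Some ([::], s).
Proof. by elim: t => // t IHt; rewrite /run iterS -/(run _ _ _) IHt. Qed.

(** This is [update] under another name: unfolding it computes the registers and
    leaves the updates of the memory alone. *)
Definition setreg (f : nat -> nat) (i v : nat) : nat -> nat :=
  fun j => if j == i then v else f j.

(** Time is a resource of which the command consumes a part: [t] steps are
    available at the start, and [Q] speaks of the steps that are left. *)
Definition wp (W : nat) (c : cmd) (Q : store -> nat -> Prop) (s : store) (t : nat) : Prop
  :=
  exists s' u, [/\ u <= t, forall k, run W u (c :: k, s) = Some (k, s') & Q s' (t - u)].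

Lemma wp_weaken W c (Q Q' : store -> nat -> Prop) s t :
  (forall s' t', Q s' t' -> Q' s' t') -> wp W c Q s t -> wp W c Q' s t.
Proof. by move=> QQ' [s' [u [ut r /QQ' q]]]; exists s', u. Qed.

Lemma wp_assign W r e (Q : store -> nat -> Prop) s t : 0 < t -> eval s e <= W ->
  Q (MkStore (setreg (regs s) r (eval s e)) (memory s)) (t - 1) -> wp W (CAssign r e) Q s
    t.
Proof.
move=> t_gt0 eW q; eexists _, 1; split; [exact: t_gt0| |exact: q].
by move=> k; rewrite /run /= eW.
Qed.

Lemma wp_fetch W r e (Q : store -> nat -> Prop) s t : 0 < t -> eval s e <= W ->
  memory s (eval s e) <= W ->
  Q (MkStore (setreg (regs s) r (memory s (eval s e))) (memory s)) (t - 1) ->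
  wp W (CFetch r e) Q s t.
Proof.
move=> t_gt0 eW mW q; eexists _, 1; split; [exact: t_gt0| |exact: q].
by move=> k; rewrite /run /= eW mW.
Qed.

Lemma wp_store W e1 e2 (Q : store -> nat -> Prop) s t : 0 < t -> eval s e1 <= W ->
  eval s e2 <= W ->
  Q (MkStore (regs s) (update (memory s) (eval s e1) (eval s e2))) (t - 1) ->
  wp W (CStore e1 e2) Q s t.
Proof.
move=> t_gt0 eW mW q; eexists _, 1; split; [exact: t_gt0| |exact: q].
by move=> k; rewrite /run /= eW mW.
Qed.

Lemma wp_prefix W c c' (Q : store -> nat -> Prop) s t : 0 < t ->
  (forall k, step W (c :: k, s) = Some (c' :: k, s)) ->
  wp W c' Q s (t - 1) -> wp W c Q s t.
Proof.
move=> t_gt0 st [s' [u [ut r q]]]; exists s', u.+1; split; first by lia.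
  by move=> k; rewrite -add1n run_add run1 st /= r.
by have -> : t - u.+1 = t - 1 - u by lia.
Qed.

Lemma wp_seq W c1 c2 (Q : store -> nat -> Prop) s t : 0 < t ->
  wp W c1 (wp W c2 Q) s (t - 1) -> wp W (CSeq c1 c2) Q s t.
Proof.
move=> t_gt0 [s1 [u1 [ut1 r1 [s2 [u2 [ut2 r2 q]]]]]].
exists s2, (u1 + u2).+1; split; first by lia.
  by move=> k; rewrite -add1n run_add run1 /= run_add r1 /= r2.
by have -> : t - (u1 + u2).+1 = t - 1 - u1 - u2 by lia.
Qed.

Lemma wp_if W e c1 c2 (Q : store -> nat -> Prop) s t : 0 < t ->
  (eval s e != 0 -> wp W c1 Q s (t - 1)) ->
  (eval s e = 0 -> wp W c2 Q s (t - 1)) -> wp W (CIf e c1 c2) Q s t.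
Proof.
move=> t_gt0 q1 q2; have [e0|e_neq0] := eqVneq (eval s e) 0.
  by apply: (@wp_prefix _ _ c2) (q2 e0) => // k; rewrite /= e0.
by apply: (@wp_prefix _ _ c1) (q1 e_neq0) => // k; rewrite /= e_neq0.
Qed.

(** Every test of the condition costs a step, so that an invariant that guarantees
    a positive budget also guarantees termination. *)
Lemma wp_while W e c (I Q : store -> nat -> Prop) s t :
  (forall s t, I s t -> 0 < t) ->
  (forall s t, I s t -> eval s e != 0 -> wp W c I s (t - 1)) ->
  (forall s t, I s t -> eval s e = 0 -> Q s (t - 1)) ->
  I s t -> wp W (CWhile e c) Q s t.
Proof.
move=> I_pos I_body I_exit; elim/ltn_ind: t s => t IHt s Ist.
have t_gt0 := I_pos _ _ Ist; have [e0|e_neq0] := eqVneq (eval s e) 0.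
  exists s, 1; split=> //; last exact: I_exit.
  by move=> k; rewrite /run /= e0.
have [s1 [u1 [ut1 r1 I1]]] := I_body _ _ Ist e_neq0.
have lt1 : t - 1 - u1 < t by lia.
have [s2 [u2 [ut2 r2 q]]] := IHt _ lt1 s1 I1.
exists s2, (u1 + u2).+1; split; first by lia.
  by move=> k; rewrite -add1n run_add run1 /= e_neq0 run_add r1 /= r2.
by have -> : t - (u1 + u2).+1 = t - 1 - u1 - u2 by lia.
Qed.

Ltac wp_step :=
  lazymatch goal with
  | |- wp _ (CSeq _ _) _ _ _ => apply: wp_seq; [lia|]
  | |- wp _ (CAssign _ _) _ _ _ => apply: wp_assign; [lia| |]; rewrite /setreg /=
  | |- wp _ (CFetch _ _) _ _ _ => apply: wp_fetch; [lia| | |]; rewrite /setreg /=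
  | |- wp _ (CStore _ _) _ _ _ => apply: wp_store; [lia| | |]; rewrite /setreg /=
  end.

Lemma wp_computes W p input t (Q : nat -> Prop) :
  wp W p (fun s _ => Q (regs s 0)) (initial_config p input).2 t ->
  exists2 out, computes_within W p input t out & Q out.
Proof.
move=> [s [u [ut r q]]]; exists (regs s 0) => //; exists s; split=> //.
by rewrite -(subnKC ut) run_add r /= run_halted.
Qed.

(** [fuel i] is a budget that suffices from the [i]-th iteration on. *)
Lemma wp_for W e c (J : nat -> store -> Prop) (fuel : nat -> nat) lo hi
    (Q : store -> nat -> Prop) s t :
  (forall i s t, i < hi -> J i s -> fuel i <= t ->
     [/\ 0 < t, eval s e != 0 &
      wp W c (fun s' t' => J i.+1 s' /\ fuel i.+1 <= t') s (t - 1)]) ->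
  (forall s t, J hi s -> fuel hi <= t -> [/\ 0 < t, eval s e = 0 & Q s (t - 1)]) ->
  lo <= hi -> J lo s -> fuel lo <= t -> wp W (CWhile e c) Q s t.
Proof.
move=> body exit lo_hi Jlo fuel_lo.
pose I s t := exists i, [/\ i <= hi, J i s & fuel i <= t].
have step u v : I u v -> (exists2 i, i < hi & J i u /\ fuel i <= v) \/ (J hi u /\ fuel hi
  <= v).
  move=> [i [le_i Ji fi]]; have [lt_i|ge_i] := ltnP i hi; first by left; exists i.
  by right; have <- : i = hi by apply/eqP; rewrite eqn_leq le_i.
apply: (@wp_while _ _ _ I) => [u v|u v|u v|]; last by exists lo.
- by case/step=> [[i lt_i [Ji fi]]|[Jhi fhi]];
  [have [] := body _ _ _ lt_i Ji fi|have [] := exit _ _ Jhi fhi].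
- case/step=> [[i lt_i [Ji fi]] _|[Jhi fhi]].
    have [_ _] := body _ _ _ lt_i Ji fi; apply: wp_weaken => u' v' [J' f'].
    by exists i.+1.
  by have [_ -> _] := exit _ _ Jhi fhi.
- case/step=> [[i lt_i [Ji fi]]|[Jhi fhi] _].
    by have [_ /eqP] := body _ _ _ lt_i Ji fi.
  by have [] := exit _ _ Jhi fhi.
Qed.

Declare Scope cmd_scope.
Delimit Scope cmd_scope with cmd.
Infix ";;" := CSeq (at level 90, right associativity) : cmd_scope.
Notation "r ::= e" := (CAssign r e) (at level 80, e at level 75) : cmd_scope.

(** The arrays are interleaved: cell [i] of array number [k < 8] is at address
    [P + (8 * i + k)].  They are disjoint whatever their lengths, and start after
    an input of length [P]. *)
Definition array (m : nat -> nat) (P k len : nat) (f : nat -> nat) : Prop :=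
  forall i, i < len -> m (P + (8 * i + k)) = f i.

Lemma array_other m P k len f k' i v : k != k' -> k < 8 -> k' < 8 ->
  array m P k len f -> array (update m (P + (8 * i + k')) v) P k len f.
Proof.
move=> neq_k k8 k'8 am j /am <-; rewrite /update ifF //; apply/negP; lia.
Qed.

Lemma array_same m P k len f i v :
  array m P k len f -> array (update m (P + (8 * i + k)) v) P k len (setreg f i v).
Proof.
move=> am j lt_j; rewrite /update /setreg eqn_add2l eqn_add2r eqn_pmul2l //.
by case: eqP => // _; exact: am.
Qed.

Lemma eq_array m P k len f f' : (forall i, i < len -> f i = f' i) ->
  array m P k len f -> array m P k len f'.
Proof. by move=> eq_f am i lt_i; rewrite am ?eq_f. Qed.

(** * Trimming the graph *)

Section Trimming.

Variables (n first : nat) (letter node : nat -> nat).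

Hypothesis node_id : forall k, node k != 0 -> node k = k.
Hypothesis node_lt : forall k, k <= n -> 0 < n -> node k < n.

Local Notation pair_edge := (pair_edge n first letter).
Local Notation pair_node := (pair_node n node).
Local Notation edges := (edges n first letter).

Implicit Types (live : nat -> pred (nat * nat)) (R : pred (nat * nat)) (q : seq nat).

Definition deg (d : nat) (R : pred (nat * nat)) (v : nat) : nat :=
  count (fun e => (pair_node d e == v) && R e) edges.

Lemma size_edges : size edges <= n * n.
Proof.
by rewrite size_filter (leq_trans (count_size _ _)) // size_allpairs size_iota.
Qed.

Lemma deg_le d R v : deg d R v <= n * n.
Proof. exact: leq_trans (count_size _ _) size_edges. Qed.

Lemma eq_deg d (R R' : pred (nat * nat)) v : (forall e, pair_edge e -> R e = R' e) -> deg
  d R v = deg d R' v.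
Proof. by move=> eqR; apply: eq_in_count => e; rewrite mem_edges => /eqR ->. Qed.

Lemma deg_add d (R R' : pred (nat * nat)) e v : pair_edge e -> R' e -> ~~ R e ->
  (forall e', pair_edge e' -> e' != e -> R' e' = R e') ->
  deg d R' v = deg d R v + (v == pair_node d e).
Proof.
rewrite -(mem_edges n first letter) => e_in R'e Re eqR.
have rem_e R1 : deg d R1 v =
    ((pair_node d e == v) && R1 e) +
    count (fun e' => (pair_node d e' == v) && R1 e') (rem e edges).
  by rewrite /deg (permP (perm_to_rem e_in)).
rewrite !rem_e R'e (negPf Re) andbT andbF add0n addnC eq_sym; congr (_ + _).
apply: eq_in_count => e'; rewrite mem_rem_uniq ?edges_uniq // inE mem_edges.
by move=> /andP[neq_e e'edge]; rewrite eqR.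
Qed.

Lemma deg_gt0P d (R : pred (nat * nat)) v : reflect (exists e, [/\ pair_edge e, pair_node
  d e = v & R e]) (0 < deg d R v).
Proof.
rewrite -has_count; apply: (iffP hasP) => [[e]|[e [e_edge ev Re]]].
  by rewrite mem_edges => e_edge /andP[/eqP ? ?]; exists e.
by exists e; rewrite ?mem_edges // ev eqxx.
Qed.

Lemma node_pair_le i j : i <= n -> j <= n -> 0 < n -> node i * n + node j < n * n.
Proof.
move=> i_n j_n n_gt0; have := node_lt i_n n_gt0; have := node_lt j_n n_gt0.
move: (node i) (node j) => p q q_lt p_lt.
by apply: (@leq_trans (p.+1 * n)); [rewrite mulSn; lia|rewrite leq_mul2r p_lt orbT].
Qed.

Lemma pair_node_lt d e : d <= 1 -> pair_edge e -> pair_node d e < n * n.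
Proof. by move=> d1 /and4P[e1 e2 _ _]; apply: node_pair_le; lia. Qed.

Definition closed_set (T : nat -> Prop) : Prop :=
  (forall v, T v -> exists e, [/\ pair_edge e, pair_node 0 e = v & T (pair_node 1 e)]) /\
  (forall v, T v -> exists e, [/\ pair_edge e, pair_node 1 e = v & T (pair_node 0 e)]).

Definition dead (live : nat -> pred (nat * nat)) (v : nat) : bool :=
  (deg 0 (live 0) v == 0) || (deg 1 (live 1) v == 0).

Lemma dead_sides live v d : d <= 1 ->
  dead live v = (deg d (live d) v == 0) || (deg (1 - d) (live (1 - d)) v == 0).
Proof. by case: d => [|[]] // _; rewrite ?subn0 ?subnn // orbC. Qed.

(** An edge leaves [live 0] when its target is removed and [live 1] when its source
    is, so that [deg d (live d)] counts the remaining neighbours on each side.  The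
    queue holds all the removed nodes, those whose edges are still to be withdrawn
    included. *)
Record trimming (live : nat -> pred (nat * nat)) (q : seq nat) : Prop := Trimming {
  queue_uniq : uniq q;
  queue_lt v : v \in q -> v < n * n;
  queue_dead v : v < n * n -> (v \in q) = dead live v;
  live_or_gone d e : d <= 1 -> pair_edge e -> ~~ live d e -> pair_node (1 - d) e \in q;
  queue_safe T v : closed_set T -> v \in q -> ~ T v }.

(** A node of [T] has a neighbour in [T] on each side, through edges that are still
    live. *)
Lemma dead_outside live T v : closed_set T ->
  (forall d e, d <= 1 -> pair_edge e -> T (pair_node (1 - d) e) -> live d e) ->
  dead live v -> ~ T v.
Proof.
move=> [T0 T1] alive dead_v Tv.
case/orP: dead_v; apply/negP; rewrite -lt0n; apply/deg_gt0P.
  by have [e [e_edge ev Te]] := T0 _ Tv; exists e; split=> //; exact: (alive 0).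
by have [e [e_edge ev Te]] := T1 _ Tv; exists e; split=> //; exact: (alive 1).
Qed.

Lemma eq_trimming live live' q :
  (forall d e, d <= 1 -> pair_edge e -> live d e = live' d e) ->
  trimming live q -> trimming live' q.
Proof.
move=> eq_live tr; split;
  [exact: queue_uniq tr|exact: queue_lt tr| | |exact: queue_safe tr].
  move=> v lt_v; rewrite (queue_dead tr lt_v) /dead.
  rewrite (eq_deg 0 v (R' := live' 0)) => [|e]; last exact: eq_live.
  by rewrite (eq_deg 1 v (R' := live' 1)) // => e; exact: eq_live.
by move=> d e d1 e_edge; rewrite -eq_live //; exact: (live_or_gone tr).
Qed.

Definition cut_edge (live : nat -> pred (nat * nat)) d e : nat -> pred (nat * nat) :=
  fun d' e' => live d' e' && ~~ ((d' == d) && (e' == e)).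

Lemma deg_cut live d e v : pair_edge e -> live d e ->
  deg d (live d) v = deg d (cut_edge live d e d) v + (v == pair_node d e).
Proof.
move=> e_edge live_e; apply: deg_add => // [|e' _ neq_e].
  by rewrite /cut_edge !eqxx andbF.
by rewrite /cut_edge eqxx (negPf neq_e) andbT.
Qed.

Lemma deg_cut_other live d d' e v : d' != d ->
  deg d' (cut_edge live d e d') v = deg d' (live d') v.
Proof. by move=> neq_d; apply: eq_deg => e' _; rewrite /cut_edge (negPf neq_d) andbT. Qed.

(** Only the degree of [w] changes.  If the other degree of [w] is 0, then [w] is in the
    queue already; otherwise it enters the queue when its degree drops
    from 1 to 0. *)
Lemma cut_edge_trimming live q d e : d <= 1 -> pair_edge e -> live d e ->
  pair_node (1 - d) e \in q -> trimming live q ->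
  let w := pair_node d e in
  trimming (cut_edge live d e)
    (if (deg d (live d) w == 1) && (0 < deg (1 - d) (live (1 - d)) w) then rcons q w else
      q).
Proof.
move=> d1 e_edge live_e e_q tr w; set live' := cut_edge live d e.
have w_lt : w < n * n by exact: pair_node_lt.
have deg_w : deg d (live d) w = (deg d (live' d) w).+1.
  by rewrite (deg_cut w e_edge live_e) eqxx addn1.
have degE v : deg d (live d) v = deg d (live' d) v + (v == w) := deg_cut v e_edge live_e.
have deg'E v : deg (1 - d) (live' (1 - d)) v = deg (1 - d) (live (1 - d)) v.
  by apply: deg_cut_other; case: (d) d1 => [|[]].
have deadE l v := dead_sides l v d1.
have gone d' e' : d' <= 1 -> pair_edge e' -> ~~ live' d' e' -> pair_node (1 - d') e' \in
  q.
  move=> d1' e'_edge; rewrite negb_and negbK => /orP[|/andP[/eqP -> /eqP ->]] //.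
  exact: (live_or_gone tr).
rewrite deg_w eqSS -deg'E; case: ifP => [/andP[deg0 deg'_gt0]|no_push].
  have w_notin : w \notin q by rewrite (queue_dead tr) // deadE deg_w -deg'E /= -lt0n.
  have tr_q : trimming live q := tr.
  split.
  - by rewrite rcons_uniq w_notin (queue_uniq tr).
  - by move=> v; rewrite mem_rcons inE => /predU1P[->//|/(queue_lt tr)].
  - move=> v lt_v; rewrite mem_rcons inE (queue_dead tr) // !deadE degE -deg'E.
    have [->|neq_v] := eqVneq v w; first by rewrite deg0.
    by rewrite addn0.
  - by move=> d' e' d1' e'_edge /gone e'_q; rewrite mem_rcons inE e'_q ?orbT.
  - move=> T v T_closed; rewrite mem_rcons inE => /predU1P[->|];
    last exact: (queue_safe tr).
    move=> Tw; have [T0 T1] := T_closed.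
    have : exists u, [/\ pair_edge u, pair_node d u = w & T (pair_node (1 - d) u)].
      by case: (d) d1 => [|[]] // _; [exact: T0|exact: T1].
    move=> [u [u_edge uw Tu]]; have : 0 < deg d (live' d) w.
      apply/deg_gt0P; exists u; split=> //; apply: contraPT Tu => /gone u_q.
      exact: (queue_safe tr T_closed) (u_q d1 u_edge).
    by rewrite (eqP deg0).
split; [exact: queue_uniq tr|exact: queue_lt tr| |exact: gone|exact: queue_safe tr].
move=> v lt_v; rewrite (queue_dead tr) // !deadE degE -deg'E.
have [->|neq_v] := eqVneq v w; last by rewrite addn0.
rewrite addn1 /=; move: no_push; rewrite lt0n.
by case: eqP => //= _ /negbFE ->.
Qed.

(** * The trimming program *)

Variables (W P : nat).
Hypothesis W_large : P + 8 * (n * n + n + 2) <= W.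
Hypothesis letter_le : forall k, k < n -> letter k <= W.

(** Use of the registers:
    - 0: the answer;  1: the address P;  2: n;  3: the size of the first word;
    - 4: the number of words;  5: the index of a word;  6: an address in the input;
      7: the size of a word;
    - 8, 9: two occurrences i and j (8 also runs over
      a word and over the nodes, and 9 holds a letter that is copied);
    - 10: whether (i, j) is an edge (an index in the text while it is copied);
      11, 12: the source and the target of (i, j);
    - 13, 14, 15: auxiliary values;
    - 16, 17: the end and the head of the queue;
    - 18: a removed node;  19, 20: its two components;
    - 21, 22: the ends of the ranges of i and j.

    Use of the arrays: 0 holds the letter of each occurrence, 1 its node, 2 and 3
    the numbers of live outgoing and incoming edges of each node, 4 the queue. *)
Local Notation R := EReg.
Local Notation C := EConst.

Definition cell (k : nat) (e : expr) : expr :=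
  EBin OpAdd (R 1) (EBin OpAdd (EBin OpMul (C 8) e) (C k)).

Definition same_regs (l : seq nat) (f g : nat -> nat) : Prop :=
  forall r, r \notin l -> f r = g r.

Definition constants (f : nat -> nat) : Prop := [/\ f 1 = P, f 2 = n & f 3 = first].

Definition tables (m : nat -> nat) : Prop := array m P 0 n letter /\ array m P 1 n.+1
  node.

Definition load_edge : cmd :=
  (CFetch 14 (cell 0 (R 8));; CFetch 15 (cell 0 (R 9));;
   10 ::= EBin OpMul (EBin OpEq (R 14) (R 15))
           (EBin OpAdd (EBin OpLt (EBin OpEq (R 8) (R 9)) (C 1)) (EBin OpLt (R 8) (R
             3)));;
   CFetch 14 (cell 1 (R 8));; CFetch 15 (cell 1 (R 9));;
   11 ::= EBin OpAdd (EBin OpMul (R 14) (R 2)) (R 15);;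
   CFetch 14 (cell 1 (EBin OpAdd (R 8) (C 1)));;
   CFetch 15 (cell 1 (EBin OpAdd (R 9) (C 1)));;
   12 ::= EBin OpAdd (EBin OpMul (R 14) (R 2)) (R 15))%cmd.

Lemma cell_le k c : k <= n * n + n -> c < 8 -> P + (8 * k + c) <= W.
Proof. by move=> k_le c8; apply: leq_trans W_large; lia. Qed.

Lemma row_cell_le k c : k <= n -> c < 8 -> P + (8 * k + c) <= W.
Proof. by move=> k_n; apply: cell_le; apply: leq_trans k_n _; exact: leq_addl. Qed.

Lemma bound_le v : v <= n * n + n -> v <= W.
Proof. by move=> v_le; apply: leq_trans (cell_le v_le (isT : 0 < 8)); lia. Qed.

Lemma row_le v : v <= n -> v <= W.
Proof. by move=> v_n; apply: bound_le; apply: leq_trans v_n _; exact: leq_addl. Qed.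

Lemma state_le v : v <= n * n -> v <= W.
Proof. by move=> v_n; apply: bound_le; apply: leq_trans v_n _; exact: leq_addr. Qed.

Lemma wp_load_edge Q f m i j t : 17 <= t -> constants f -> tables m ->
  f 8 = i -> f 9 = j -> i < n -> j < n ->
  (forall g, same_regs [:: 10; 11; 12; 14; 15] g f ->
     (g 10 != 0) = pair_edge (i, j) -> g 11 = pair_node 0 (i, j) ->
     g 12 = pair_node 1 (i, j) -> Q (MkStore g m) (t - 17)) ->
  wp W load_edge Q (MkStore f m) t.
Proof.
move=> t_ge [fP fn ff] [mL mS] fi fj i_n j_n post.
have n_gt0 : 0 < n by exact: leq_ltn_trans i_n.
have lWn k : k < n -> node k <= W.
  by move=> k_n; apply/row_le/ltnW/node_lt => //; exact: ltnW.
have lWn1 k : k < n -> node k.+1 <= W by move=> k_n; apply/row_le/ltnW/node_lt.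
have b0 : node i * n + node j <= W by apply/state_le/ltnW/node_pair_le => //; exact: ltnW.
have b1 : node i.+1 * n + node j.+1 <= W by apply/state_le/ltnW/node_pair_le.
rewrite /load_edge.
have mLi : m (P + (8 * i + 0)) = letter i by exact: mL.
have mLj : m (P + (8 * j + 0)) = letter j by exact: mL.
have mSi : m (P + (8 * i + 1)) = node i by apply: mS; lia.
have mSj : m (P + (8 * j + 1)) = node j by apply: mS; lia.
have mSi1 : m (P + (8 * (i + 1) + 1)) = node i.+1 by rewrite mS ?(addn1 i) // ltnW.
have mSj1 : m (P + (8 * (j + 1) + 1)) = node j.+1 by rewrite mS ?(addn1 j) // ltnW.
have ai k : k <= 1 -> P + (8 * i + k) <= W by move=> k1; apply: row_cell_le; lia.
have aj k : k <= 1 -> P + (8 * j + k) <= W by move=> k1; apply: row_cell_le; lia.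
have ai1 : P + (8 * (i + 1) + 1) <= W by apply: row_cell_le; rewrite // addn1.
have aj1 : P + (8 * (j + 1) + 1) <= W by apply: row_cell_le; rewrite // addn1.
wp_step; wp_step; rewrite ?fP ?fi ?mLi; [exact: ai|exact: letter_le|].
wp_step; wp_step; rewrite ?fP ?fj ?mLj; [exact: aj|exact: letter_le|].
wp_step; wp_step; rewrite ?ff ?fi ?fj.
  apply: (@leq_trans 2); last by apply: leq_trans W_large; lia.
  by case: (letter i == letter j); case: (_ < 1); case: (i < first).
wp_step; wp_step; rewrite ?fP ?fi ?mSi; [exact: ai|exact: lWn|].
wp_step; wp_step; rewrite ?fP ?fj ?mSj; [exact: aj|exact: lWn|].
wp_step; wp_step; rewrite ?fn; [exact: b0|].
wp_step; wp_step; rewrite ?fP ?fi ?mSi1; [exact: ai1|exact: lWn1|].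
wp_step; wp_step; rewrite ?fP ?fj ?mSj1; [exact: aj1|exact: lWn1|].
wp_step; rewrite ?fn; [exact: b1|].
rewrite -!subnDA; apply: post => //=; last by rewrite /pair_node /= !addn1.
- by move=> r; rewrite !inE; do 5?case: eqP.
- by rewrite /pair_edge /= i_n j_n; case: (letter i == letter j); case: (i == j);
  case: (i < first).
- by rewrite /pair_node /= !addn0.
Qed.

Record graph_state (live : nat -> pred (nat * nat)) (q : seq nat) (f m : nat -> nat) :
  Prop :=
  GraphState {
  state_constants : constants f;
  state_tables : tables m;
  state_degrees d : d <= 1 -> array m P (2 + d) (n * n) (deg d (live d));
  state_queue : array m P 4 (size q) (nth 0 q);
  state_tail : f 16 = size q }.

Lemma eq_graph_state live live' q f m :
  (forall d e, d <= 1 -> pair_edge e -> live d e = live' d e) ->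
  graph_state live q f m -> graph_state live' q f m.
Proof.
move=> eq_live [cs tabs degs que tl]; split=> // d d1.
by apply: eq_array (degs d d1) => u _; apply: eq_deg => e; exact: eq_live.
Qed.

Lemma graph_state_regs live q f g m : [/\ g 1 = f 1, g 2 = f 2, g 3 = f 3 & g 16 = f 16]
  ->
  graph_state live q f m -> graph_state live q g m.
Proof. by move=> [g1 g2 g3 g16] [[? ? ?] tabs degs que tl]; split; rewrite ?g16 //;
  split; rewrite ?g1 ?g2 ?g3. Qed.

Lemma tables_update m k c v : 1 < c -> c < 8 -> tables m -> tables (update m (P + (8 * k
  + c)) v).
Proof. by move=> c1 c8 [mL mS]; split; apply: array_other => //; lia. Qed.

Lemma array_rcons m q w :
  array m P 4 (size q) (nth 0 q) ->
  array (update m (P + (8 * size q + 4)) w) P 4 (size (rcons q w)) (nth 0 (rcons q w)).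
Proof.
move=> am i; rewrite size_rcons ltnS leq_eqVlt nth_rcons => /predU1P[->|lt_i].
  by rewrite ltnn eqxx /update eqxx.
by rewrite lt_i -am // /update ifF //; apply/negP; lia.
Qed.

Lemma queue_size_le live q : trimming live q -> size q <= n * n.
Proof.
move=> tr; have := @uniq_leq_size _ q (iota 0 (n * n)) (queue_uniq tr).
by rewrite size_iota; apply=> v /(queue_lt tr); rewrite mem_iota.
Qed.

Lemma queue_size live q v : trimming live q ->
  v < n * n -> v \notin q -> size q < n * n.
Proof.
move=> tr lt_v v_q; have := @uniq_leq_size _ (rcons q v) (iota 0 (n * n)).
rewrite size_rcons size_iota; apply; first by rewrite rcons_uniq v_q (queue_uniq tr).
by move=> u; rewrite mem_rcons inE mem_iota => /predU1P[->//|/(queue_lt tr)].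
Qed.

(** Register [11 + d] holds the node whose degree decreases. *)
Definition drop_edge (d : nat) : cmd :=
  (CFetch 13 (cell (2 + d) (R (11 + d)));; CFetch 14 (cell (3 - d) (R (11 + d)));;
   CStore (cell (2 + d) (R (11 + d))) (EBin OpSub (R 13) (C 1));;
   CIf (EBin OpMul (EBin OpEq (R 13) (C 1)) (EBin OpLt (C 0) (R 14)))
     (CStore (cell 4 (R 16)) (R (11 + d));; 16 ::= EBin OpAdd (R 16) (C 1))
     (13 ::= R 13))%cmd.

Lemma wp_drop_edge Q live q d e f m t : 12 <= t -> d <= 1 -> graph_state live q f m ->
  trimming live q -> pair_edge e -> live d e ->
  pair_node (1 - d) e \in q -> f (11 + d) = pair_node d e ->
  (forall g m' l t', t - 12 <= t' -> same_regs [:: 13; 14; 16] g f ->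
     graph_state (cut_edge live d e) (q ++ l) g m' ->
     trimming (cut_edge live d e) (q ++ l) ->
     Q (MkStore g m') t') ->
  wp W (drop_edge d) Q (MkStore f m) t.
Proof.
move=> t_ge d1 gs tr e_edge live_e e_q fw post.
set w := pair_node d e in fw; have w_lt : w < n * n by exact: pair_node_lt.
have [[fP fn ff] tabs degs queue tail] := gs.
have mw : m (P + (8 * w + (2 + d))) = deg d (live d) w by exact: degs.
have mw' : m (P + (8 * w + (3 - d))) = deg (1 - d) (live (1 - d)) w.
  have -> : 3 - d = 2 + (1 - d) by lia.
  by apply: degs => //; exact: leq_subr.
have w_cell c : c < 8 -> P + (8 * w + c) <= W.
  by move=> c8; apply: cell_le => //; apply: leq_trans (ltnW w_lt) _; exact: leq_addr.
have deg_W d' : deg d' (live d') w <= W by apply/state_le/deg_le.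
have /= tr' := cut_edge_trimming d1 e_edge live_e e_q tr; rewrite -/w in tr'.
have degs' d' v : d' <= 1 -> deg d' (cut_edge live d e d') v =
    if (d' == d) && (v == w) then (deg d (live d) w).-1 else deg d' (live d') v.
  move=> d1'; have [->|neq_d] := eqVneq d' d; last exact: deg_cut_other.
  rewrite (deg_cut v e_edge live_e) (deg_cut w e_edge live_e) eqxx addn1 /= -/w.
  by have [->|_] := eqVneq v w; rewrite ?addn0.
have n13 : (11 + d == 13) = false by lia.
have n14 : (11 + d == 14) = false by lia.
have n16 : (11 + d == 16) = false by lia.
rewrite /drop_edge.
wp_step; wp_step; rewrite fP fw ?mw; [by apply: w_cell; lia|exact: deg_W|].
wp_step; wp_step; rewrite ?n13 ?fP ?fw ?mw'; [by apply: w_cell; lia|exact: deg_W|].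
wp_step; wp_step; rewrite ?n14 ?n13 ?fP ?fw.
- by apply: w_cell; lia.
- exact: leq_trans (leq_subr _ _) (deg_W d).
set m1 := update m _ _.
have tabs1 : tables m1 by apply: tables_update => //; lia.
have queue1 : array m1 P 4 (size q) (nth 0 q) by apply: array_other => //; lia.
have degs1 d' : d' <= 1 -> array m1 P (2 + d') (n * n) (deg d' (cut_edge live d e d')).
  move=> d1'; have [eq_d|neq_d] := eqVneq d' d.
    subst d'; apply: eq_array (array_same _ _ (degs d d1)) => v _.
    by rewrite /setreg degs' // eqxx /= subn1.
  apply: eq_array (array_other _ _ _ _ _ (degs d' d1')); try lia.
  by move=> v _; rewrite degs' // (negPf neq_d).
apply: wp_if; [lia|rewrite /= mulnb eqb0 negbK => push|rewrite /= => /eqP;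
  rewrite mulnb eqb0 => push].
  have w_q : w \notin q.
    rewrite (queue_dead tr w_lt); move: push => /andP[/eqP deg1 deg'_gt0].
    by rewrite (dead_sides _ _ d1) deg1 negb_or /= -lt0n.
  have size_q := queue_size tr w_lt w_q.
  wp_step; wp_step; rewrite ?n14 ?n13 ?fP ?fw ?tail.
  - by apply: cell_le => //; apply: leq_trans (ltnW size_q) _; exact: leq_addr.
  - exact/state_le/ltnW.
  wp_step; rewrite tail addn1; first exact: state_le.
  rewrite push in tr'; rewrite -cats1 in tr'.
  apply: (post _ _ _ _ _ _ _ tr'); first lia.
    by move=> r; rewrite !inE; do 3?case: eqP.
  split=> //=; last by rewrite size_cat addn1.
  - by apply: tables_update.
  - by move=> d' d1'; apply: array_other (degs1 d' d1') => //; lia.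
  - by rewrite cats1; apply: array_rcons.
rewrite (negPf push) in tr'; rewrite -(cats0 q) in tr'.
wp_step; first exact: deg_W.
apply: (post _ _ _ _ _ _ _ tr'); first lia.
  by move=> r; rewrite !inE; do 3?case: eqP.
by split; rewrite ?cats0.
Qed.

Definition scan_row (dir : nat) : cmd :=
  CWhile (EBin OpLt (R 9) (R 22))
    (load_edge;;
     CIf (EBin OpMul (EBin OpLt (C 0) (R 10)) (EBin OpEq (R (11 + dir)) (R 18)))
       (drop_edge (1 - dir)) (13 ::= C 0);;
     9 ::= EBin OpAdd (R 9) (C 1))%cmd.

(** The range of the occurrences that can have the node in register [k] as source
    ([dir = 0]) or as target ([dir = 1]). *)
Definition scan_range (dir lo hi k : nat) : cmd :=
  CIf (EBin OpEq (R k) (C 0))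
    (lo ::= C 0;; hi ::= R 2)%cmd
    (lo ::= EBin OpSub (R k) (C dir);; hi ::= EBin OpAdd (R lo) (C 1))%cmd.

(** Withdraws the edges whose source ([dir = 0]) or target ([dir = 1]) is the node of
    register 18.  Since such an edge counts in the degree of its other end, it is
    dropped from side [1 - dir]. *)
Definition scan (dir : nat) : cmd :=
  (scan_range dir 8 21 19;;
   CWhile (EBin OpLt (R 8) (R 21))
     (scan_range dir 9 22 20;; scan_row dir;; 8 ::= EBin OpAdd (R 8) (C 1)))%cmd.

Definition scratch : seq nat := [:: 8; 9; 10; 11; 12; 13; 14; 15; 16; 21; 22].

Definition cut_node (live : nat -> pred (nat * nat)) dir v : nat -> pred (nat * nat) :=
  fun d e => live d e && ~~ ((d == 1 - dir) && (pair_node dir e == v)).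

Definition range_lo (dir x : nat) : nat := if x == 0 then 0 else x - dir.
Definition range_width (x : nat) : nat := if x == 0 then n else 1.

Section Scan.

Variables (dir : nat) (live : nat -> pred (nat * nat)) (q : seq nat) (f : nat -> nat) (x
  y : nat).
Hypothesis dir1 : dir <= 1.
Let v := x * n + y.
Hypotheses (x_lt : x < n) (y_lt : y < n).
Hypotheses (f18 : f 18 = v) (f19 : f 19 = x) (f20 : f 20 = y).
Hypothesis v_q : v \in q.
Hypothesis v_live : forall e, pair_edge e -> pair_node dir e = v -> live (1 - dir) e.

Definition scanned (i j : nat) (e : nat * nat) : bool := (e.1 < i) || ((e.1 == i) && (e.2
  < j)).

Definition live_at (i j : nat) : nat -> pred (nat * nat) :=
  fun d e => live d e && ~~ [&& d == 1 - dir, pair_node dir e == v & scanned i j e].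

Definition scan_state (i j : nat) (s : store) : Prop := exists l,
  [/\ graph_state (live_at i j) (q ++ l) (regs s) (memory s), trimming (live_at i j) (q
    ++ l)
    & same_regs scratch (regs s) f].

Lemma scanned_next i j e : scanned i j.+1 e = scanned i j e || (e == (i, j)).
Proof.
case: e => a b; rewrite /scanned xpair_eqE /=.
by have [->|] := eqVneq a i; rewrite ?ltnn ?orbF //= ltnS leq_eqVlt orbC.
Qed.

(** A node other than 0 determines the occurrence before it and the one after it. *)
Lemma edge_range e : pair_edge e -> pair_node dir e = v ->
  range_lo dir x <= e.1 < range_lo dir x + range_width x /\
  range_lo dir y <= e.2 < range_lo dir y + range_width y.
Proof.
move=> /and4P[e1 e2 _ _] ev; have n_gt0 : 0 < n by lia.
have lt_node k : k < n -> node (k + dir) < n.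
  by move=> k_n; apply: node_lt => //; apply: leq_trans k_n;
    rewrite -[X in _ <= X]addn1 leq_add2l.
have node_x : node (e.1 + dir) = x.
  have := congr1 (divn^~ n) ev.
  by rewrite /= /v /pair_node !divnMDl // !divn_small ?lt_node // !addn0.
have node_y : node (e.2 + dir) = y.
  by have := congr1 (modn^~ n) ev; rewrite /= /v /pair_node !modnMDl !modn_small ?lt_node.
have range a k : a < n -> node (a + dir) = k -> range_lo dir k <= a < range_lo dir k +
  range_width k.
  move=> a_n nodek; rewrite /range_lo /range_width; have [//|k_neq0] := eqVneq k 0.
  have := node_id (k := a + dir); rewrite nodek => /(_ k_neq0) ->.
  by rewrite addnK leqnn addn1 ltnSn.
by split; apply: range.
Qed.

Lemma scan_state_eq i j i' j' s :
  (forall e, pair_edge e -> pair_node dir e = v -> scanned i j e = scanned i' j' e) ->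
  scan_state i j s -> scan_state i' j' s.
Proof.
move=> eq_sc [l [gs tr sr]]; exists l.
have eq_live d e : pair_edge e -> live_at i j d e = live_at i' j' d e.
  rewrite /live_at => e_edge; case: (pair_node dir e =P v) => [ev|_];
    last by rewrite !andbF.
  by rewrite eq_sc.
split=> //; first by apply: eq_graph_state gs => d e _; exact: eq_live.
by apply: eq_trimming tr => d e _; exact: eq_live.
Qed.

Lemma wp_scan_row Q rest i s t : i < n -> scan_state i (range_lo dir y) s ->
  regs s 8 = i -> regs s 9 = range_lo dir y -> regs s 22 = range_lo dir y + range_width y
    ->
  range_width y * 40 + 1 + rest <= t ->
  (forall s' t', rest <= t' -> scan_state i (range_lo dir y + range_width y) s' ->
     regs s' 8 = i -> regs s' 21 = regs s 21 -> Q s' t') ->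
  wp W (scan_row dir) Q s t.
Proof.
move=> i_n st0 s8 s9 s22 t_ge post.
set lo := range_lo dir y in st0 s9 s22 post *; set hi := lo + range_width y in s22 post *.
have hi_n : hi <= n.
  rewrite /hi /lo /range_lo /range_width; case: (y == 0); first by rewrite add0n.
  by apply: leq_trans y_lt; rewrite addn1 ltnS leq_subr.
pose J j s' := [/\ scan_state i j s', regs s' 8 = i, regs s' 9 = j, regs s' 22 = hi &
  regs s' 21 = regs s 21].
apply: (@wp_for _ _ _ J (fun j => (hi - j) * 40 + 1 + rest) lo hi); last first.
- by rewrite /hi addKn.
- by [].
- exact: leq_addr.
- move=> s' t' [st s8' s9' s22' s21'] t'_ge; split; [lia|by rewrite /= s9' s22' ltnn|].
  by apply: post => //; lia.
move=> j [g m] t' j_hi [[l [/= gs tr sr]] s8' s9' s22' s21'] t'_ge.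
rewrite /= in s8' s9' s22' s21'.
split; [lia|by rewrite /= s9' s22' j_hi|].
have fuelE : (hi - j) * 40 = (hi - j.+1) * 40 + 40 by lia.
have j_n : j < n by exact: leq_trans hi_n.
wp_step; apply: (@wp_load_edge _ _ _ i j) => //;
  [lia|exact: state_constants gs|exact: state_tables gs|].
move=> h same_h h10 h11 h12.
have hE r : r \notin [:: 10; 11; 12; 14; 15] -> h r = g r by exact: same_h.
have gs_h : graph_state (live_at i j) (q ++ l) h m.
  by apply: graph_state_regs gs; split; rewrite hE.
have same_hf : same_regs scratch h f.
  move=> r r_scratch; rewrite hE ?sr //; apply: contra r_scratch.
  by rewrite !inE; do 5?case/orP; move=> /eqP ->.
have h_dir d : d <= 1 -> h (11 + d) = pair_node d (i, j) by case: d => [|[]].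
have h18 : h 18 = v by rewrite hE // sr.
wp_step; apply: wp_if; [lia| |]; rewrite /= h_dir // h18 lt0n h10 mulnb.
  rewrite eqb0 negbK => /andP[e_edge /eqP ev].
  have dirK : 1 - (1 - dir) = dir by case: (dir) dir1 => [|[]].
  apply: (wp_drop_edge _ _ gs_h tr e_edge); rewrite ?dirK ?ev ?leq_subr //; first lia.
  - by rewrite /live_at v_live // /scanned /= !ltnn !andbF.
  - by rewrite mem_cat v_q.
  - exact: h_dir (leq_subr _ _).
  move=> h' m' l' t'' t''_ge same_h' gs' tr'.
  have h'E r : r \notin [:: 13; 14; 16] -> h' r = h r by exact: same_h'.
  wp_step.
    rewrite h'E // hE // s9' addn1; exact: row_le.
  have cutE d e : live_at i j.+1 d e = cut_edge (live_at i j) (1 - dir) (i, j) d e.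
    rewrite /live_at /cut_edge scanned_next; case: (d == 1 - dir); last by rewrite !andbT.
    by have [->|neq_e] := eqVneq e (i, j); rewrite ?ev ?eqxx ?orbT ?andbF ?orbF ?andbT.
  split; last lia.
  split=> /=; rewrite ?h'E ?hE // ?addn1 ?s9' //.
  exists (l ++ l'); rewrite catA; split=> /=.
  - apply: (@eq_graph_state (cut_edge (live_at i j) (1 - dir) (i, j))) => [d e _ _|].
      by rewrite cutE.
    by apply: graph_state_regs gs'; split.
  - apply: eq_trimming tr' => d e _ _.
    by rewrite cutE.
  - move=> r r_scratch; have [eq_r|_] := eqVneq r 9; first by rewrite eq_r in r_scratch.
    rewrite h'E ?same_hf //; apply: contra r_scratch.
    by rewrite !inE; do 2?case/orP; move=> /eqP ->.
move/eqP; rewrite eqb0 negb_and => skip.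
wp_step; first by [].
wp_step; rewrite ?hE // s9' addn1; first exact: row_le.
split; last lia.
split=> /=; rewrite ?hE //.
apply: (@scan_state_eq i j) => [e e_edge ev|].
  rewrite scanned_next; have [eq_e|_] := eqVneq e (i, j); last by rewrite orbF.
  by move: skip; rewrite -eq_e e_edge ev eqxx.
exists l; split=> //=.
  by apply: graph_state_regs gs_h; split.
move=> r r_scratch; have [eq_r|_] := eqVneq r 9; first by rewrite eq_r in r_scratch.
have [eq_r|_] := eqVneq r 13; first by rewrite eq_r in r_scratch.
exact: same_hf.
Qed.

Lemma wp_scan_range Q lo hi k z g m t : lo != hi -> lo != 2 -> hi != 2 -> lo != k -> hi
  != k ->
  5 <= t -> g 2 = n -> g k = z -> z < n ->
  (forall h t', t - 5 <= t' -> same_regs [:: lo; hi] h g -> h lo = range_lo dir z ->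
     h hi = range_lo dir z + range_width z -> Q (MkStore h m) t') ->
  wp W (scan_range dir lo hi k) Q (MkStore g m) t.
Proof.
move=> lo_hi lo2 hi2 lo_k hi_k t_ge g2 gk z_n post.
have same h u w : same_regs [:: lo; hi] (setreg (setreg h lo u) hi w) h.
  by move=> r; rewrite !inE negb_or /setreg => /andP[/negPf -> /negPf ->].
apply: wp_if; [lia| |]; rewrite /= gk => zE.
  have {zE}z0 : z = 0 by move: zE; rewrite eqb0 negbK => /eqP.
  wp_step; wp_step; first by [].
  wp_step; rewrite eq_sym (negPf lo2) g2; first exact: row_le.
  apply: post; [lia|exact: same| |]; rewrite /range_lo /range_width z0 /=.
    by rewrite (negPf lo_hi) eqxx.
  by rewrite eqxx.
have {zE}z_neq0 : z != 0 by rewrite -eqb0 zE.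
have z_dir : z - dir < n by exact: leq_ltn_trans (leq_subr _ _) z_n.
wp_step; wp_step; rewrite gk; first exact/row_le/ltnW.
wp_step; rewrite eqxx addn1; first exact: row_le.
apply: post; [lia|exact: same| |]; rewrite /range_lo /range_width (negPf z_neq0).
  by rewrite /= (negPf lo_hi) eqxx.
by rewrite /= eqxx addn1.
Qed.

Definition scan_cost : nat := 70 * (range_width x * range_width y).

Lemma range_hi_le z : z < n -> range_lo dir z + range_width z <= n.
Proof.
rewrite /range_lo /range_width; case: eqP => [_|_ z_n]; first by rewrite add0n.
by apply: leq_trans z_n; rewrite addn1 ltnS leq_subr.
Qed.

Lemma wp_scan Q m t : scan_cost <= t -> graph_state live q f m -> trimming live q ->
  (forall g m' l t', t - scan_cost <= t' -> same_regs scratch g f ->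
     graph_state (cut_node live dir v) (q ++ l) g m' ->
     trimming (cut_node live dir v) (q ++ l) -> Q (MkStore g m') t') ->
  wp W (scan dir) Q (MkStore f m) t.
Proof.
move=> t_ge gs tr post; have n_gt0 : 0 < n by exact: leq_ltn_trans x_lt.
have width_gt0 z : 0 < range_width z by rewrite /range_width; case: ifP.
have [cs _ _ _ _] := gs; have [_ f2 _] := cs.
have [row rowE] : exists row, row = range_width y * 40 + 15 by eexists.
have cost_ge : range_width x * row + 7 <= scan_cost.
  rewrite /scan_cost rowE; have := width_gt0 x; have := width_gt0 y.
  move: (range_width x) (range_width y) => a b b_gt0 a_gt0.
  have le_ab : a <= a * b by exact: leq_pmulr.
  by rewrite mulnDr (mulnA a b); lia.
have st0 g : same_regs [:: 8; 21] g f -> scan_state (range_lo dir x) 0 (MkStore g m).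
  move=> same_g; exists [::]; rewrite cats0.
  have eq_live d e : pair_edge e -> live d e = live_at (range_lo dir x) 0 d e.
    move=> e_edge; rewrite /live_at; case: (pair_node dir e =P v) => [ev|_];
      last by rewrite !andbF andbT.
    have [/andP[lo_e _] _] := edge_range e_edge ev.
    by rewrite /scanned ltnNge lo_e ltn0 !andbF andbT.
  split=> /=.
  - apply: (@eq_graph_state live) => [d e _|]; first exact: eq_live.
    by apply: graph_state_regs gs; split; rewrite same_g.
  - by apply: eq_trimming tr => d e _; exact: eq_live.
  - move=> r r_scratch; apply: same_g; apply: contra r_scratch.
    by rewrite !inE; do 1?case/orP; move=> /eqP ->.
rewrite /scan; wp_step; apply: (wp_scan_range (z := x)) => //; first lia.
move=> g t' t'_ge same_g g8 g21.
set lo := range_lo dir x in g8 g21 st0; set hi := lo + range_width x in g21.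
have hi_n : hi <= n by exact: range_hi_le.
pose J i s := [/\ scan_state i 0 s, regs s 8 = i & regs s 21 = hi].
apply: (@wp_for _ _ _ J (fun i => (hi - i) * row + 1 + (t - scan_cost)) lo hi);
  last first.
- by rewrite /hi addKn; lia.
- by split=> //; exact: st0.
- exact: leq_addr.
- move=> [h m'] t'' [st /= s8 s21] t''_ge; split; [lia|by rewrite /= s8 s21 ltnn|].
  move: st => [l [/= gs' tr' same']].
  have eq_live d e : pair_edge e -> live_at hi 0 d e = cut_node live dir v d e.
    move=> e_edge; rewrite /live_at /cut_node; case: (pair_node dir e =P v) => [ev|_];
      last by rewrite !andbF.
    have [/andP[_ e_hi] _] := edge_range e_edge ev.
    by rewrite /scanned e_hi andbT.
  apply: (post _ _ l) => //; first lia.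
    by apply: eq_graph_state gs' => d e _; exact: eq_live.
  by apply: eq_trimming tr' => d e _; exact: eq_live.
move=> i [h m'] t'' i_hi [st /= s8 s21] t''_ge.
have [fuel [fuelS fuelE]] : exists fuel, (hi - i.+1) * row = fuel /\ (hi - i) * row =
  fuel + row.
  by eexists; split; [reflexivity|rewrite -(subnSK i_hi) mulSn addnC].
rewrite fuelS; rewrite fuelE in t''_ge.
have row_ge : 15 <= row by rewrite rowE leq_addl.
split; [lia|by rewrite s8 s21 i_hi|].
have i_n : i < n by exact: leq_trans hi_n.
have [l [/= gs' tr' same']] := st.
have [[hP h2 h3] _ _ _ _] := gs'.
wp_step; apply: (wp_scan_range (z := y)) => //; [lia|by rewrite same'|].
move=> h1 t1 t1_ge same_h1 h1_9 h1_22.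
have h1E r : r \notin [:: 9; 22] -> h1 r = h r by exact: same_h1.
wp_step; apply: (@wp_scan_row _ (fuel + 3 + (t - scan_cost)) i) => //=.
- apply: (@scan_state_eq i 0) => [e e_edge ev|].
    have [_ /andP[lo_e _]] := edge_range e_edge ev.
    by rewrite /scanned ltn0 [e.2 < _]ltnNge lo_e.
  exists l; split=> //=.
    by apply: graph_state_regs gs'; split; rewrite h1E.
  move=> r r_scratch; rewrite h1E ?same' //; apply: contra r_scratch.
  by rewrite !inE; do 1?case/orP; move=> /eqP ->.
- by rewrite h1E.
- lia.
move=> [h' m2] t2 t2_ge st2 /= h'8 h'21.
wp_step; rewrite h'8 addn1; first exact: row_le.
split; last lia.
split=> //=; last by rewrite h'21 h1E.
have [l2 [/= gs2 tr2 same2]] : scan_state i.+1 0 (MkStore h' m2).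
  apply: scan_state_eq st2 => e e_edge ev; have [_ /andP[_ e_hi]] := edge_range e_edge ev.
  by rewrite /scanned e_hi ltn0 andbT andbF orbF ltnS (leq_eqVlt e.1 i) orbC.
exists l2; split=> //=.
  by apply: graph_state_regs gs2; split.
by move=> r r_scratch; case: (r =P 8) => [eq_r|_];
  [rewrite eq_r in r_scratch|exact: same2].
Qed.

End Scan.

Definition live_outside (done : seq nat) : nat -> pred (nat * nat) :=
  fun d e => pair_node (1 - d) e \notin done.

(** The number of pairs that each scan tests when [v] is removed. *)
Definition weight (v : nat) : nat := range_width (v %/ n) * range_width (v %% n).

(** The budget for the nodes that are still to be removed: 160 steps per tested
    pair cover the two scans and the rest of an iteration. *)
Definition remaining (done : seq nat) : nat :=
  \sum_(v <- iota 0 (n * n) | v \notin done) 160 * weight v.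

Lemma remaining_rcons done v : v < n * n -> v \notin done ->
  remaining done = 160 * weight v + remaining (rcons done v).
Proof.
move=> v_lt v_done; rewrite /remaining (big_rem v) ?mem_iota //= v_done.
congr (_ + _); rewrite rem_filter ?iota_uniq // big_filter_cond.
by apply: eq_bigl => u; rewrite mem_rcons inE negb_or.
Qed.

Lemma sum_divmod (F : nat -> nat -> nat) a b : 0 < b ->
  \sum_(0 <= v < a * b) F (v %/ b) (v %% b) = \sum_(0 <= x < a) \sum_(0 <= y < b) F x y.
Proof.
move=> b_gt0; elim: a => [|a IHa]; first by rewrite mul0n !big_geq.
rewrite big_nat_recr //= -IHa mulSn (addnC b) (@big_cat_nat _ _ _ (a * b)) ?leq_addr //=.
congr (_ + _); rewrite -[X in \sum_(X <= _ < _) _]add0n big_addn addKn.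
rewrite !big_nat; apply: eq_bigr => y /andP[_ y_b].
by rewrite addnC divnMDl // modnMDl divn_small // modn_small // addn0.
Qed.

(** Node 0 has [n] candidates and each of the [n - 1] others has one, so that the
    weights add up to at most [(2 * n) ^ 2]. *)
Lemma remaining_le : remaining [::] <= 640 * (n * n).
Proof.
have [n0|n_gt0] := posnP n; first by rewrite /remaining n0 big_nil.
have -> : remaining [::] = \sum_(0 <= v < n * n) 160 * weight v.
  by rewrite /remaining /index_iota subn0; apply: eq_bigl => v.
rewrite -big_distrr /= (sum_divmod (fun x y => range_width x * range_width y)) //.
have sum_width : \sum_(0 <= y < n) range_width y <= n + n.
  rewrite big_ltn // {1}/range_width eqxx leq_add2l.
  rewrite (eq_big_nat _ _ (F2 := fun=> 1)) => [|y /andP[y_gt0 _]].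
    by rewrite sum_nat_const_nat muln1 leq_subr.
  by rewrite /range_width gtn_eqF.
rewrite (eq_bigr (fun x => range_width x * \sum_(0 <= y < n) range_width y)) => [|x _].
  rewrite -big_distrl /= -[640]/(160 * 4) -mulnA leq_mul2l /=.
  by apply: leq_trans (leq_mul sum_width sum_width) _; lia.
by rewrite big_distrr.
Qed.

Definition trim_loop : cmd :=
  (17 ::= C 0;;
   CWhile (EBin OpLt (R 17) (R 16))
     (CFetch 18 (cell 4 (R 17));; 19 ::= EBin OpDiv (R 18) (R 2);;
      20 ::= EBin OpMod (R 18) (R 2);; 17 ::= EBin OpAdd (R 17) (C 1);;
      scan 0;; scan 1))%cmd.

Lemma wp_trim_loop Q rest q f m t : remaining [::] + 5 + rest <= t ->
  graph_state (fun _ _ => true) q f m -> trimming (fun _ _ => true) q ->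
  (forall g m' q' t', rest <= t' -> graph_state (live_outside q') q' g m' ->
     trimming (live_outside q') q' -> Q (MkStore g m') t') ->
  wp W trim_loop Q (MkStore f m) t.
Proof.
move=> t_ge gs0 tr0 post.
pose I s t := exists h q, [/\ h <= size q, regs s 17 = h,
  graph_state (live_outside (take h q)) q (regs s) (memory s),
  trimming (live_outside (take h q)) q & remaining (take h q) + 1 + rest <= t].
rewrite /trim_loop; wp_step; wp_step; first by [].
apply: (@wp_while _ _ _ I) => [s u|[g m'] u|[g m'] u|].
- by move=> [h [q' [_ _ _ _ fuel]]]; lia.
- move=> [h [q' [_ /= h17 gs tr fuel]]] /=.
  have [[fP fn ff] tabs degs que tl] := gs; rewrite h17 tl eqb0 negbK => h_lt.
  set v := nth 0 q' h; have v_q : v \in q' by exact: mem_nth.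
  have v_lt : v < n * n := queue_lt tr v_q.
  have n_gt0 : 0 < n by case: (n) v_lt.
  have v_done : v \notin take h q'.
    have := queue_uniq tr; rewrite -{1}(cat_take_drop h q') cat_uniq (drop_nth 0 h_lt).
    by move=> /and3P[_ /hasPn/(_ v (mem_head _ _))].
  have take_next : take h.+1 q' = rcons (take h q') v by exact: take_nth.
  have h_n : h < n * n by exact: leq_trans h_lt (queue_size_le tr).
  have := remaining_rcons v_lt v_done; rewrite -take_next => remE; rewrite remE in fuel.
  have weight_gt0 : 0 < weight v.
    by rewrite /weight /range_width muln_gt0; do 2 case: ifP; rewrite ?n_gt0.
  pose x := v %/ n; pose y := v %% n.
  have vE : x * n + y = v by rewrite -divn_eq.
  have x_lt : x < n by rewrite ltn_divLR.
  have y_lt : y < n by rewrite ltn_mod.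
  have costE : scan_cost x y = 70 * weight v by [].
  have mq : m' (P + (8 * h + 4)) = v by exact: que.
  wp_step; wp_step; rewrite ?fP ?h17 ?mq.
  - by apply: cell_le => //; apply: leq_trans (ltnW h_n) _; exact: leq_addr.
  - exact/state_le/ltnW.
  wp_step; wp_step; rewrite ?fn -/x; first exact/row_le/ltnW.
  wp_step; wp_step; rewrite ?fn -/y; first exact/row_le/ltnW.
  wp_step; wp_step; rewrite ?h17 addn1.
    exact: state_le.
  wp_step; set g1 := (X in MkStore X _).
  have g1E r : r \notin [:: 17; 18; 19; 20] -> g1 r = g r.
    by rewrite !inE /g1; do 4?case: eqP.
  have gs1 : graph_state (live_outside (take h q')) q' g1 m'.
    by apply: graph_state_regs gs; split.
  have live0 e : pair_edge e -> pair_node 0 e = v -> live_outside (take h q') (1 - 0) e.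
    by move=> _ ev; rewrite /live_outside subn0 subnn ev.
  apply: (@wp_scan 0 (live_outside (take h q')) q' g1 x y) => //; rewrite ?vE ?costE //.
    by lia.
  move=> g2 m2 l2 t2 t2_ge same2 gs2 tr2.
  have g2E r : r \notin scratch -> g2 r = g1 r by exact: same2.
  have live1 e : pair_edge e -> pair_node 1 e = v ->
      cut_node (live_outside (take h q')) 0 v (1 - 1) e.
    by move=> _ ev; rewrite /cut_node /live_outside subnn subn0 ev v_done.
  apply: (@wp_scan 1 (cut_node (live_outside (take h q')) 0 v) (q' ++ l2) g2 x y) => //;
    rewrite ?vE ?costE ?g2E // ?mem_cat ?v_q //; first by lia.
  move=> g3 m3 l3 t3 t3_ge same3 gs3 tr3.
  have g3E r : r \notin scratch -> g3 r = g2 r by exact: same3.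
  have take_cat3 : take h.+1 ((q' ++ l2) ++ l3) = take h.+1 q'.
    rewrite -catA take_cat; case: ltnP => // ge_h.
    have -> : h.+1 = size q' by apply/eqP; rewrite eqn_leq h_lt.
    by rewrite subnn take0 cats0 take_size.
  have eq_live d e : d <= 1 -> cut_node (cut_node (live_outside (take h q')) 0 v) 1 v d e
    =
      live_outside (take h.+1 ((q' ++ l2) ++ l3)) d e.
    rewrite take_cat3 take_next /cut_node /live_outside mem_rcons inE negb_or.
    case: d => [|[|//]] _; rewrite ?subn0 ?subnn /= ?andbT ?andTb; first by rewrite andbC.
    by rewrite andbC.
  exists h.+1, ((q' ++ l2) ++ l3); split=> //=.
  - by rewrite -catA size_cat; apply: leq_trans h_lt _; exact: leq_addr.
  - by rewrite g3E // g2E.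
  - by apply: eq_graph_state gs3 => d e d1 _; exact: eq_live.
  - by apply: eq_trimming tr3 => d e d1 _; exact: eq_live.
  - by rewrite take_cat3; lia.
- move=> [h [q' [h_le /= h17 gs tr fuel]]]; rewrite h17 (state_tail gs) => /eqP.
  rewrite eqb0 -leqNgt => h_ge; have eq_h : h = size q' by apply/eqP;
    rewrite eqn_leq h_le.
  by rewrite eq_h take_size in gs tr; apply: post gs tr; lia.
exists 0, q; rewrite take0; split=> //=; last by lia.
- apply: (@eq_graph_state (fun=> predT)) => [d e _ _|]; first by [].
  by apply: graph_state_regs gs0; split.
Qed.

Definition initialize_degrees : cmd :=
  (8 ::= C 0;;
   CWhile (EBin OpLt (R 8) (R 2))
     (9 ::= C 0;;
      CWhile (EBin OpLt (R 9) (R 2))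
        (load_edge;;
         CIf (R 10)
           (CFetch 13 (cell 2 (R 11));; CStore (cell 2 (R 11)) (EBin OpAdd (R 13) (C 1));;
            CFetch 13 (cell 3 (R 12));; CStore (cell 3 (R 12)) (EBin OpAdd (R 13) (C 1)))
           (13 ::= C 0);;
         9 ::= EBin OpAdd (R 9) (C 1));;
      8 ::= EBin OpAdd (R 8) (C 1)))%cmd.

Definition initialize_queue : cmd :=
  (8 ::= C 0;;
   CWhile (EBin OpLt (R 8) (EBin OpMul (R 2) (R 2)))
     (CFetch 13 (cell 2 (R 8));; CFetch 14 (cell 3 (R 8));;
      CIf (EBin OpEq (EBin OpMul (R 13) (R 14)) (C 0))
        (CStore (cell 4 (R 16)) (R 8);; 16 ::= EBin OpAdd (R 16) (C 1))
        (13 ::= C 0);;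
      8 ::= EBin OpAdd (R 8) (C 1)))%cmd.

Definition check_degrees : cmd :=
  (0 ::= C 1;; 8 ::= C 0;;
   CWhile (EBin OpLt (R 8) (EBin OpMul (R 2) (R 2)))
     (CFetch 13 (cell 2 (R 8));; CFetch 14 (cell 3 (R 8));;
      CIf (EBin OpMul (EBin OpLt (C 1) (R 13)) (EBin OpLt (C 0) (R 14)))
        (0 ::= C 0) (13 ::= C 0);;
      8 ::= EBin OpAdd (R 8) (C 1)))%cmd.

(** The second condition says that [v] has not been removed, provided that its first
    degree is positive. *)
Definition branching (live : nat -> pred (nat * nat)) (v : nat) : bool :=
  (1 < deg 0 (live 0) v) && (0 < deg 1 (live 1) v).

Lemma wp_check_degrees Q live q f m t : 20 * (n * n) + 10 <= t ->
  graph_state live q f m ->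
  (forall (g : nat -> nat) t', g 0 = all (fun v => ~~ branching live v) (iota 0 (n * n))
    ->
     Q (MkStore g m) t') ->
  wp W check_degrees Q (MkStore f m) t.
Proof.
move=> t_ge gs post; have [[fP fn ff] tabs degs que tl] := gs.
pose ok i : bool := all (fun v => ~~ branching live v) (iota 0 i).
pose J i s := [/\ memory s = m, constants (regs s), regs s 8 = i & regs s 0 = ok i].
rewrite /check_degrees; wp_step; wp_step; first by apply: leq_trans W_large; lia.
wp_step; wp_step; first by [].
apply: (@wp_for _ _ _ J (fun i => (n * n - i) * 20 + 1) 0 (n * n)) => //=; last by lia.
  move=> i [g m'] u i_lt [/= -> gc g8 g0] fuel; have [gP gn gf] := gc.
  split; [lia|by rewrite g8 gn i_lt|].
  have m2 : m (P + (8 * i + 2)) = deg 0 (live 0) i by exact: (degs 0).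
  have m3 : m (P + (8 * i + 3)) = deg 1 (live 1) i by exact: (degs 1).
  have iW c : c < 8 -> P + (8 * i + c) <= W.
    by move=> c8; apply: cell_le => //; apply: leq_trans (ltnW i_lt) _; exact: leq_addr.
  have degW d : deg d (live d) i <= W by apply/state_le/deg_le.
  wp_step; wp_step; rewrite ?gP ?g8 ?m2; [exact: iW|exact: degW|].
  wp_step; wp_step; rewrite ?gP ?g8 ?m3; [exact: iW|exact: degW|].
  have okS : ok i.+1 = ok i && ~~ branching live i.
    by rewrite /ok -addn1 iotaD all_cat add0n /= andbT.
  wp_step; apply: wp_if; [lia| |]; rewrite /= mulnb.
    rewrite eqb0 negbK => bi; wp_step; first by [].
    wp_step; rewrite g8 addn1; first exact: state_le.
    by split; [split=> //=; rewrite okS /branching bi andbF|lia].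
  move/eqP; rewrite eqb0 => bi; wp_step; first by [].
  wp_step; rewrite g8 addn1; first exact: state_le.
  by split; [split=> //=; rewrite okS /branching (negPf bi) andbT|lia].
move=> [g m'] u [/= -> [gP gn gf] g8 g0] fuel; split; [lia|by rewrite g8 gn ltnn|].
exact: post.
Qed.

Lemma wp_initialize_queue Q rest f m t : 20 * (n * n) + 10 + rest <= t ->
  graph_state (fun _ _ => true) [::] f m ->
  (forall g m' q t', rest <= t' -> graph_state (fun _ _ => true) q g m' ->
     trimming (fun _ _ => true) q -> Q (MkStore g m') t') ->
  wp W initialize_queue Q (MkStore f m) t.
Proof.
move=> t_ge gs0 post; pose live0 : nat -> pred (nat * nat) := fun _ _ => true.
pose queue i := [seq v <- iota 0 i | dead live0 v].
pose J i s := graph_state live0 (queue i) (regs s) (memory s) /\ regs s 8 = i.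
rewrite /initialize_queue; wp_step; wp_step; first by [].
apply: (@wp_for _ _ _ J (fun i => (n * n - i) * 20 + 1 + rest) 0 (n * n)) => //=;
  last by lia.
- move=> i [g m'] u i_lt [/= gs g8] fuel; have [[gP gn gf] tabs degs que tl] := gs.
  split; [lia|by rewrite g8 gn i_lt|].
  have m2 : m' (P + (8 * i + 2)) = deg 0 (live0 0) i by exact: (degs 0).
  have m3 : m' (P + (8 * i + 3)) = deg 1 (live0 1) i by exact: (degs 1).
  have iW c : c < 8 -> P + (8 * i + c) <= W.
    by move=> c8; apply: cell_le => //; apply: leq_trans (ltnW i_lt) _; exact: leq_addr.
  have degW d : deg d (live0 d) i <= W by apply/state_le/deg_le.
  wp_step; wp_step; rewrite ?gP ?g8 ?m2; [exact: iW|exact: degW|].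
  wp_step; wp_step; rewrite ?gP ?g8 ?m3; [exact: iW|exact: degW|].
  have queueS : queue i.+1 = if dead live0 i then rcons (queue i) i else queue i.
    by rewrite /queue -addn1 iotaD filter_cat add0n /=; case: ifP; rewrite ?cats1 ?cats0.
  have size_q : size (queue i) <= i.
    by rewrite size_filter; apply: leq_trans (count_size _ _) _; rewrite size_iota.
  have q_lt : size (queue i) < n * n by exact: leq_ltn_trans i_lt.
  wp_step; apply: wp_if; [lia| |]; rewrite /= => dead_i.
    have {}dead_i : dead live0 i by move: dead_i; rewrite eqb0 negbK muln_eq0.
    rewrite dead_i in queueS.
    wp_step; wp_step; rewrite ?gP ?g8 ?tl.
    + by apply: cell_le => //; apply: leq_trans (ltnW q_lt) _; exact: leq_addr.
    + exact/state_le/ltnW.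
    wp_step; rewrite tl addn1; first exact: state_le.
    wp_step; rewrite g8 addn1; first exact: state_le.
    split; last lia; split=> //=; rewrite queueS; split=> //=.
    + exact: tables_update.
    + by move=> d d1; apply: array_other (degs d d1) => //; lia.
    + exact: array_rcons.
    + by rewrite size_rcons addn1.
  have {}dead_i : dead live0 i = false by move/eqP: dead_i;
    rewrite eqb0 muln_eq0 => /negPf.
  rewrite dead_i in queueS.
  wp_step; first by [].
  wp_step; rewrite g8 addn1; first exact: state_le.
  by split; last lia; split=> //=; rewrite queueS; split.
- move=> [g m'] u [/= gs g8] fuel; have [[gP gn gf] _ _ _ _] := gs.
  split; [lia|by rewrite g8 gn ltnn|]; apply: (post _ _ (queue (n * n))) => //; first lia.
  split=> //; first by rewrite filter_uniq ?iota_uniq.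
  + by move=> v; rewrite mem_filter mem_iota => /andP[].
  + by move=> v v_lt; rewrite mem_filter mem_iota add0n v_lt /= andbT.
  + by move=> T v T_closed; rewrite mem_filter => /andP[+ _]; apply: dead_outside.
- split=> //=; exact: graph_state_regs gs0.
Qed.

Lemma wp_initialize_degrees Q rest f m t : 40 * (n * n) + 20 * n + 10 + rest <= t ->
  graph_state (fun _ _ => false) [::] f m ->
  (forall g m' t', rest <= t' -> graph_state (fun _ _ => true) [::] g m' ->
     Q (MkStore g m') t') ->
  wp W initialize_degrees Q (MkStore f m) t.
Proof.
move=> t_ge gs0 post.
pose counted i j : nat -> pred (nat * nat) := fun _ => scanned i j.
pose J i s := graph_state (counted i 0) [::] (regs s) (memory s) /\ regs s 8 = i.
rewrite /initialize_degrees; wp_step; wp_step; first by [].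
have [row rowE] : exists row, row = 40 * n + 10 by eexists.
apply: (@wp_for _ _ _ J (fun i => (n - i) * row + 1 + rest) 0 n) => //=; last first.
- by rewrite subn0 rowE mulnDr mulnCA; lia.
- split=> //=; apply: (@eq_graph_state (fun _ _ => false)) => [d e _ _|].
    by rewrite /counted /scanned !ltn0 andbF.
  by apply: graph_state_regs gs0; split.
- move=> [g m'] u [/= gs g8] fuel; have [[gP gn gf] _ _ _ _] := gs.
  split; [lia|by rewrite g8 gn ltnn|]; apply: post; first lia.
  apply: eq_graph_state gs => d e _ /and4P[e1 _ _ _].
  by rewrite /counted /scanned e1.
move=> i [g m'] u i_n [/= gs g8]; have [[gP gn gf] _ _ _ _] := gs.
have [fuel [-> ->]] : exists fuel, (n - i.+1) * row = fuel /\ (n - i) * row = fuel + row.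
  by eexists; split; [reflexivity|rewrite -(subnSK i_n) mulSn addnC].
move=> u_ge; split; [lia|by rewrite g8 gn i_n|].
wp_step; wp_step; first by [].
pose K j s := [/\ graph_state (counted i j) [::] (regs s) (memory s), regs s 8 = i & regs
  s 9 = j].
wp_step; apply: (@wp_for _ _ _ K (fun j => (n - j) * 40 + 4 + fuel + rest) 0 n) => //=;
  last first.
- by rewrite subn0; lia.
- split=> //=.
  by apply: graph_state_regs gs; split.
- move=> [g1 m1] u1 [/= gs1 g18 g19] u1_ge; have [[g1P g1n g1f] _ _ _ _] := gs1.
  split; [lia|by rewrite g19 g1n ltnn|].
  wp_step; rewrite g18 addn1; first exact: row_le.
  split; last lia; split=> //=.
  apply: (@eq_graph_state (counted i n)) => [d e _ /and4P[_ e2 _ _]|].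
    by rewrite /counted /scanned e2 ltn0 andbT andbF orbF ltnS (leq_eqVlt e.1 i) orbC.
  by apply: graph_state_regs gs1; split.
move=> j [g1 m1] u1 j_n [/= gs1 g18 g19] u1_ge; have [[g1P g1n g1f] _ _ _ _] := gs1.
split; [lia|by rewrite g19 g1n j_n|].
wp_step; apply: (@wp_load_edge _ _ _ i j) => //; [lia|exact: state_tables gs1|].
move=> h same_h h10 h11 h12.
have hE r : r \notin [:: 10; 11; 12; 14; 15] -> h r = g1 r by exact: same_h.
have gs_h : graph_state (counted i j) [::] h m1.
  by apply: graph_state_regs gs1; split; rewrite hE.
have h8 : h 8 = i by rewrite hE.
have h9 : h 9 = j by rewrite hE.
have [[hP hn hf] tabs degs que tl] := gs_h.
wp_step; apply: wp_if; [lia| |]; rewrite /= => e_edge.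
  rewrite h10 in e_edge.
  have degS d v : deg d (counted i j.+1 d) v = deg d (counted i j d) v + (v == pair_node
    d (i, j)).
    apply: deg_add => //; rewrite /counted ?scanned_next ?eqxx ?orbT //.
      by rewrite /scanned !ltnn andbF.
    by move=> e _ neq_e; rewrite scanned_next (negPf neq_e) orbF.
  have deg_step d v : setreg (deg d (counted i j d)) (pair_node d (i, j))
      (deg d (counted i j d) (pair_node d (i, j)) + 1) v = deg d (counted i j.+1 d) v.
    by rewrite degS /setreg; case: eqP => [->|_]; rewrite ?addn0 // addn1.
  have wW d c : d <= 1 -> c < 8 -> P + (8 * pair_node d (i, j) + c) <= W.
    move=> d1 c8; apply: cell_le => //;
      apply: leq_trans (ltnW (pair_node_lt d1 e_edge)) _.
    exact: leq_addr.
  have degW d : deg d (counted i j d) (pair_node d (i, j)) + 1 <= W.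
    rewrite addn1; apply/bound_le; apply: (@leq_trans (n * n + 1));
      first by rewrite addn1 ltnS deg_le.
    by rewrite leq_add2l; exact: leq_ltn_trans i_n.
  have degW' d : deg d (counted i j d) (pair_node d (i, j)) <= W.
    exact: leq_trans (leq_addr _ _) (degW d).
  have m2 : m1 (P + (8 * pair_node 0 (i, j) + 2)) = deg 0 (counted i j 0) (pair_node 0
    (i, j)).
    by apply: (degs 0) => //; exact: pair_node_lt.
  wp_step; wp_step; rewrite ?hP ?h11 ?m2; [exact: wW|exact: degW'|].
  wp_step; wp_step; rewrite ?hP ?h11; [exact: wW|exact: degW|].
  set m2' := update m1 _ _.
  have degs0 : array m2' P 2 (n * n) (deg 0 (counted i j.+1 0)).
    by apply: eq_array (array_same _ _ (degs 0 isT)) => v _; exact: deg_step.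
  have degs1 : array m2' P 3 (n * n) (deg 1 (counted i j 1)).
    by apply: array_other (degs 1 isT).
  have m3 : m2' (P + (8 * pair_node 1 (i, j) + 3)) = deg 1 (counted i j 1) (pair_node 1
    (i, j)).
    by apply: degs1; exact: pair_node_lt.
  wp_step; wp_step; rewrite ?hP ?h12 ?m3; [exact: wW|exact: degW'|].
  wp_step; rewrite ?hP ?h12; [exact: wW|exact: degW|].
  wp_step; rewrite h9 addn1; first exact: row_le.
  split; last lia; split=> //=; split=> //=.
  - by do 2 apply: tables_update => //.
  - case=> [|[|//]] _; first exact: array_other degs0.
    by apply: eq_array (array_same _ _ degs1) => v _; exact: deg_step.
have no_edge : pair_edge (i, j) = false by rewrite -h10 e_edge.
wp_step; first by [].
wp_step; rewrite h9 addn1; first exact: row_le.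
split; last lia; split=> //=.
apply: (@eq_graph_state (counted i j)) => [d e _ e_edge'|].
  rewrite /counted scanned_next; have [eq_e|_] := eqVneq e (i, j); last by rewrite orbF.
  by rewrite eq_e no_edge in e_edge'.
by apply: graph_state_regs gs_h; split.
Qed.

Definition analyze : cmd :=
  (initialize_degrees;; initialize_queue;; trim_loop;; check_degrees)%cmd.

Lemma count_gt1P (T : eqType) (a : pred T) (s : seq T) : uniq s ->
  reflect (exists x y, [/\ x \in s, y \in s, a x, a y & x != y]) (1 < count a s).
Proof.
move=> s_uniq; rewrite -size_filter; apply: (iffP idP) => [|[x [y [xs ys ax ay neq]]]].
  have := filter_uniq a s_uniq;
    have sub : {subset filter a s <= s} := mem_subseq (filter_subseq a s).
  have := filter_all a s; case: (filter a s) sub => [|x [|y l]] //= sub.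
  move=> /and3P[ax ay _] /andP[x_l _] _; exists x, y.
  split=> //; [apply: sub|apply: sub|]; rewrite ?inE ?eqxx ?orbT //.
  by apply: contraNneq x_l => ->; rewrite mem_head.
have := @uniq_leq_size _ [:: x; y] (filter a s); apply; first by rewrite /= inE neq.
by move=> z; rewrite !inE mem_filter => /orP[] /eqP ->; apply/andP.
Qed.

Definition outside (q : seq nat) : pred nat := fun v => (v < n * n) && (v \notin q).

(** When the queue is exhausted, the live edges on each side of a node are those
    whose other end has not been removed. *)
Lemma outside_essential q : trimming (live_outside q) q ->
  essential n first letter node (outside q).
Proof.
move=> tr; have alive v : outside q v -> 0 < deg 0 (live_outside q 0) v /\ 0 < deg 1
  (live_outside q 1) v.
  by move=> /andP[v_lt]; rewrite (queue_dead tr) // negb_or -!lt0n => /andP.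
have inside d e : d <= 1 -> pair_edge e -> live_outside q (1 - d) e -> outside q
  (pair_node d e).
  move=> d1 e_edge; rewrite /live_outside /outside pair_node_lt //.
  by case: d d1 => [|[]].
split=> [v /alive[/deg_gt0P[e [e_edge ev live_e]] _]|v /alive[_ /deg_gt0P[e [e_edge ev
  live_e]]]|T T0 T1 v Tv].
- by exists e; split=> //; exact: (inside 1).
- by exists e; split=> //; exact: (inside 0).
have [e [e_edge ev Te]] := T0 _ Tv; rewrite /outside -{1}ev pair_node_lt //=.
by apply/negP => v_q; exact: (queue_safe tr (conj T0 T1) v_q Tv).
Qed.

Lemma branching_deterministic q : trimming (live_outside q) q ->
  all (fun v => ~~ branching (live_outside q) v) (iota 0 (n * n)) <->
  deterministic n first letter node (outside q).
Proof.
move=> tr; split=> [no_branch e e' | det].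
  move=> /and3P[e_edge Ee0 Ee1] /and3P[e'_edge Ee'0 Ee'1] eq_src;
    apply/eqP/negPn/negP => neq_e.
  have /andP[v_lt v_q] := Ee0.
  have /allP/(_ (pair_node 0 e)) := no_branch;
    rewrite mem_iota add0n v_lt => /(_ isT)/negP; apply.
  move: v_q; rewrite (queue_dead tr) // negb_or -!lt0n => /andP[_ deg1];
    rewrite /branching deg1 andbT.
  apply/(count_gt1P _ (edges_uniq _ _ _)); exists e, e';
    rewrite !mem_edges eq_src eqxx /live_outside.
  by move: Ee1 Ee'1 => /andP[_ ->] /andP[_ ->].
apply/allP => v; rewrite mem_iota add0n => /andP[_ v_lt]; apply/negP => /andP[deg0 deg1].
have v_q : v \notin q by rewrite (queue_dead tr) // negb_or -!lt0n (ltnW deg0).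
move/(count_gt1P _ (edges_uniq _ _ _)): deg0 => [e [e' []]]; rewrite !mem_edges.
move=> e_edge e'_edge /andP[/eqP ev live_e] /andP[/eqP e'v live_e'] /eqP; apply.
apply: det; rewrite ?ev ?e'v // /inner_edge ?e_edge ?e'_edge ?ev ?e'v /outside v_lt v_q
  /= pair_node_lt //.
Qed.

Lemma wp_analyze Q f m t : 740 * (n * n) + 20 * n + 60 <= t ->
  graph_state (fun _ _ => false) [::] f m ->
  (forall (g : nat -> nat) m' t' (b : bool) E, g 0 = b -> essential n first letter node E
    ->
     (b <-> deterministic n first letter node E) -> Q (MkStore g m') t') ->
  wp W analyze Q (MkStore f m) t.
Proof.
move=> t_ge gs0 post; rewrite /analyze.
(* Each phase leaves the budget of the following ones. *)
wp_step; apply: (@wp_initialize_degrees _ (700 * (n * n) + 45)) gs0 _; first lia.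
move=> f1 m1 t1 t1_ge gs1.
wp_step; apply: (@wp_initialize_queue _ (680 * (n * n) + 30)) gs1 _; first lia.
move=> f2 m2 q2 t2 t2_ge gs2 tr2.
have rem := remaining_le.
wp_step; apply: (@wp_trim_loop _ (20 * (n * n) + 15)) gs2 tr2 _; first lia.
move=> f3 m3 q3 t3 t3_ge gs3 tr3.
apply: wp_check_degrees gs3 _; first lia.
move=> g t' g0; apply: post g0 (outside_essential tr3) _.
exact: branching_deterministic.
Qed.

End Trimming.

(** * Reading the input *)

Definition listing (l : seq (seq nat)) : seq nat := flatten [seq size w :: w | w <- l].

Lemma size_listing l : size (listing l) = size l + size (flatten l).
Proof. by elim: l => //= w l IHl; rewrite !size_cat IHl /=; lia. Qed.

Section Reading.

Variables (ws : seq (seq nat)) (b W : nat).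

Let input : seq nat := [:: size ws, b & listing ws].
Let n := size (flatten ws).
Let P := size input.
Let letter := nth 0 (flatten ws).
Let node := word_node (shape ws).

Hypothesis W_large : P + 8 * (n * n + n + 2) <= W.
Hypothesis letter_le : forall k, k < n -> letter k <= W.
Hypothesis few_words : size ws <= n.

Local Notation R := EReg.
Local Notation C := EConst.

Definition measure_input : cmd :=
  (CFetch 4 (C 0);; 6 ::= C 2;; 5 ::= C 0;; 2 ::= C 0;;
   CWhile (EBin OpLt (R 5) (R 4))
     (CFetch 7 (R 6);; 2 ::= EBin OpAdd (R 2) (R 7);;
      6 ::= EBin OpAdd (R 6) (EBin OpAdd (R 7) (C 1));;
      5 ::= EBin OpAdd (R 5) (C 1));;
   1 ::= R 6;; CFetch 3 (C 2))%cmd.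

Definition copy_words : cmd :=
  (6 ::= C 2;; 5 ::= C 0;; 10 ::= C 0;;
   CWhile (EBin OpLt (R 5) (R 4))
     (CFetch 7 (R 6);; 6 ::= EBin OpAdd (R 6) (C 1);; 8 ::= C 0;;
      CWhile (EBin OpLt (R 8) (R 7))
        (CFetch 9 (R 6);; CStore (cell 0 (R 10)) (R 9);;
         CStore (cell 1 (R 10)) (EBin OpMul (R 10) (EBin OpLt (C 0) (R 8)));;
         6 ::= EBin OpAdd (R 6) (C 1);; 10 ::= EBin OpAdd (R 10) (C 1);;
         8 ::= EBin OpAdd (R 8) (C 1));;
      5 ::= EBin OpAdd (R 5) (C 1)))%cmd.

Let wd a := nth [::] ws a.
Let offset a := 2 + size (listing (take a ws)).
Let start a := size (flatten (take a ws)).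

Lemma offsetE a : a <= size ws -> offset a = 2 + a + start a.
Proof. by move=> le_a; rewrite /offset size_listing size_takel // addnA. Qed.

Lemma startS a : a < size ws -> start a.+1 = start a + size (wd a).
Proof.
by move=> lt_a; rewrite /start (take_nth [::] lt_a) -cats1 flatten_cat size_cat /= cats0.
Qed.

Lemma offsetS a : a < size ws -> offset a.+1 = offset a + (size (wd a) + 1).
Proof. by move=> lt_a; rewrite !offsetE ?startS // 1?ltnW //; lia. Qed.

Lemma start_le a i : a < size ws -> i <= size (wd a) -> start a + i <= n.
Proof.
move=> lt_a le_i; rewrite /n -(cat_take_drop a ws) flatten_cat size_cat leq_add2l.
by rewrite (drop_nth [::] lt_a) /= size_cat; apply: leq_trans le_i _; exact: leq_addr.
Qed.

Lemma P_size : P = 2 + size ws + n.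
Proof. by rewrite /P /= size_listing. Qed.

Lemma offset_le a : a <= size ws -> offset a <= P.
Proof.
move=> le_a; rewrite offsetE // P_size /start /n -{3}(cat_take_drop a ws) flatten_cat
  size_cat.
by rewrite -addnA; lia.
Qed.

Lemma nth_input a i : a < size ws ->
  nth 0 input (offset a) = size (wd a) /\
  (i < size (wd a) -> nth 0 input (offset a + 1 + i) = letter (start a + i)).
Proof.
move=> lt_a.
have listE : listing ws = listing (take a ws) ++ (size (wd a) :: wd a) ++ listing (drop
  a.+1 ws).
  by rewrite -{1}(cat_take_drop a ws) (drop_nth [::] lt_a) /listing map_cat flatten_cat.
have flatE : flatten ws = flatten (take a ws) ++ wd a ++ flatten (drop a.+1 ws).
  by rewrite -{1}(cat_take_drop a ws) (drop_nth [::] lt_a) flatten_cat.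
rewrite /input /offset /letter /start /= listE flatE.
split=> [|lt_i]; first by rewrite nth_cat ltnn subnn.
rewrite add0n -addnA nth_cat ltnNge leq_addr /= addKn add1n /= nth_cat lt_i.
by rewrite nth_cat ltnNge leq_addr /= addKn nth_cat lt_i.
Qed.

Lemma node_start a i : a < size ws -> i < size (wd a) ->
  node (start a + i) = (start a + i) * (0 < i).
Proof.
move=> lt_a lt_i.
have -> : start a + i = flatten_index (shape ws) a i.
  by rewrite /flatten_index /start size_flatten /shape map_take.
have lt_ia : i < nth 0 (shape ws) a by rewrite (nth_map [::]).
rewrite /node /word_node flatten_indexKr // flatten_indexP //= -lt0n.
by case: (0 < i); rewrite ?muln1 ?muln0.
Qed.

Lemma input_small : [/\ size ws <= P, n <= P, 1 < P & P <= W].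
Proof.
have PW : P <= W by apply: leq_trans W_large; exact: leq_addr.
by split; rewrite // P_size; lia.
Qed.

Lemma wp_measure_input Q rest f t : 10 * n + 20 + rest <= t -> f 16 = 0 ->
  (forall g t', rest <= t' -> [/\ g 1 = P, g 2 = n, g 3 = head 0 (shape ws), g 4 = size
    ws & g 16 = 0] ->
     Q (MkStore g (nth 0 input)) t') ->
  wp W measure_input Q (MkStore f (nth 0 input)) t.
Proof.
move=> t_ge f16 post; have [sP nP P1 PW] := input_small.
have sW : size ws <= W by exact: leq_trans PW.
rewrite /measure_input; wp_step; wp_step; rewrite //=.
wp_step; wp_step; first exact: leq_trans PW.
wp_step; wp_step; first by [].
wp_step; wp_step; first by [].
pose J a s := [/\ memory s = nth 0 input, regs s 5 = a, regs s 6 = offset a, regs s 2 =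
  start a
  & regs s 4 = size ws /\ regs s 16 = 0].
wp_step; apply: (@wp_for _ _ _ J (fun a => (size ws - a) * 8 + 7 + rest) 0 (size ws)) =>
  //=; last first.
- by lia.
- split=> //=; rewrite /offset /start take0 //.
- move=> [g m] u [/= -> g5 g6 g2 [g4 g16]] fuel; split; [lia|by rewrite g5 g4 ltnn|].
  have offP : offset (size ws) = P by rewrite offsetE // /start take_size P_size.
  have startn : start (size ws) = n by rewrite /start take_size.
  wp_step; wp_step; rewrite g6 ?offP //.
  have in2 : nth 0 (listing ws) 0 = head 0 (shape ws) by rewrite /listing; case: (ws).
  wp_step; rewrite ?in2; first exact: leq_trans P1 PW.
    by apply: (@leq_trans n) => //; [rewrite /n; case: (ws) => //= w l;
      rewrite size_cat leq_addr|exact: leq_trans PW].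
  by apply: post; [lia|split=> //=; rewrite ?g2 ?in2].
move=> a [g m] u a_lt [/= -> g5 g6 g2 [g4 g16]] fuel; split; [lia|by rewrite g5 g4 a_lt|].
have [in_a _] := nth_input 0 a_lt.
have oa := offset_le (ltnW a_lt); have oa1 := offset_le a_lt; rewrite offsetS // in oa1.
have sa := start_le a_lt (leqnn _).
wp_step; wp_step; rewrite g6 ?in_a; [exact: leq_trans oa PW|lia|].
wp_step; wp_step; rewrite ?g2; first by apply: leq_trans sa _; exact: leq_trans PW.
wp_step; wp_step; rewrite ?g6; first exact: leq_trans oa1 PW.
wp_step; rewrite ?g5 addn1; first by apply: leq_trans a_lt _.
split; last lia.
by split=> //=; rewrite ?offsetS ?startS.
Qed.

(** The cells that are still 0 matter: they are the initial degrees, and cell [n] of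
    array 1 is the node of the end of the text. *)
Definition copied (k : nat) (m : nat -> nat) : Prop :=
  [/\ forall x, x < P -> m x = nth 0 input x, array m P 0 k letter, array m P 1 k node
    & forall j c, c < 8 -> (1 < c) || (k <= j) -> m (P + (8 * j + c)) = 0].

Lemma copied0 : copied 0 (nth 0 input).
Proof. by split=> // j c _ _; rewrite nth_default // /P leq_addr. Qed.

Lemma copied_next k m : copied k m ->
  copied k.+1 (update (update m (P + (8 * k + 0)) (letter k)) (P + (8 * k + 1)) (node k)).
Proof.
move=> [m_in mL mS m0]; split.
- by move=> x x_P; rewrite /update !ifF ?m_in //; apply/negP; lia.
- apply: array_other => // j; rewrite ltnS leq_eqVlt => /predU1P[->|lt_j].
    by rewrite /update eqxx.
  by rewrite -(mL j lt_j) /update ifF //; apply/negP; lia.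
- move=> j; rewrite ltnS leq_eqVlt => /predU1P[->|lt_j].
    by rewrite /update eqxx.
  by rewrite -(mS j lt_j) /update !ifF //; apply/negP; lia.
- by move=> j c c8 jc; rewrite /update !ifF ?m0 //; try lia; apply/negP; lia.
Qed.

Lemma wp_copy_words Q rest f t : 40 * n + 20 + rest <= t ->
  [/\ f 1 = P, f 2 = n, f 3 = head 0 (shape ws), f 4 = size ws & f 16 = 0] ->
  (forall g m t', rest <= t' -> [/\ g 1 = P, g 2 = n, g 3 = head 0 (shape ws) & g 16 = 0]
    ->
     copied n m -> Q (MkStore g m) t') ->
  wp W copy_words Q (MkStore f (nth 0 input)) t.
Proof.
move=> t_ge [f1 f2 f3 f4 f16] post; have [sP nP P1 PW] := input_small.
rewrite /copy_words; wp_step; wp_step; first exact: leq_trans PW.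
wp_step; wp_step; first by [].
wp_step; wp_step; first by [].
pose fixed s := [/\ regs s 1 = P, regs s 2 = n, regs s 3 = head 0 (shape ws), regs s 4 =
  size ws & regs s 16 = 0].
pose J a s := [/\ copied (start a) (memory s), fixed s, regs s 5 = a, regs s 6 = offset a
  & regs s 10 = start a].
apply: (@wp_for _ _ _ J (fun a => (size ws - a) * 14 + (n - start a) * 20 + 1 + rest) 0
  (size ws)) => //=; last first.
- by rewrite /start take0 /= !subn0; lia.
- by split=> //=; rewrite /start /offset take0 //; exact: copied0.
- move=> [g m] u [/= cm [g1 g2 g3 g4 g16] g5 g6 g10] fuel; rewrite /= in g1 g2 g3 g4 g16;
  split; [lia|by rewrite g5 g4 ltnn|].
  by rewrite /start take_size in cm; apply: post => //; lia.
move=> a [g m] u a_lt [/= cm [g1 g2 g3 g4 g16] g5 g6 g10] fuel;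
  rewrite /= in g1 g2 g3 g4 g16; split; [lia|by rewrite g5 g4 a_lt|].
have [in_a _] := nth_input 0 a_lt.
have oa := offset_le (ltnW a_lt); have oa1 := offset_le a_lt; rewrite offsetS // in oa1.
have sa := start_le a_lt (leqnn _).
have [m_in _ _ _] := cm; have oa_P : offset a < P by lia.
wp_step; wp_step; rewrite g6 ?m_in ?in_a //; [exact: leq_trans oa PW|lia|].
wp_step; wp_step; rewrite ?g6; first by lia.
wp_step; wp_step; first by [].
pose K i s := [/\ copied (start a + i) (memory s), fixed s, regs s 5 = a /\ regs s 7 =
  size (wd a),
  regs s 6 = offset a + 1 + i & regs s 10 = start a + i /\ regs s 8 = i].
wp_step; apply: (@wp_for _ _ _ K
  (fun i => (size (wd a) - i) * 20 + 4 + ((size ws - a.+1) * 14 + (n - start a.+1) * 20 +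
    1 + rest)) 0 (size (wd a))) => //=; last first.
- by rewrite subn0 startS //; lia.
- by split=> //=; rewrite ?addn0.
- move=> [h m'] v [/= cm' [h1 h2 h3 h4 h16] [h5 h7] h6 [h10 h8]] v_ge;
  rewrite /= in h1 h2 h3 h4 h16.
  split; [lia|by rewrite h8 h7 ltnn|].
  wp_step; rewrite h5 addn1; first exact: leq_trans a_lt (leq_trans sP PW).
  split; last lia.
  by split=> //=; rewrite ?h6 ?offsetS ?startS // ?h10 //; lia.
move=> i [h m'] v i_lt [/= cm' [h1 h2 h3 h4 h16] [h5 h7] h6 [h10 h8]] v_ge;
  rewrite /= in h1 h2 h3 h4 h16.
split; [lia|by rewrite h8 h7 i_lt|].
have [_ /(_ i_lt) in_ai] := nth_input i a_lt.
have [m'_in _ _ _] := cm'; have k_lt : start a + i < n.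
  by have := start_le a_lt i_lt; rewrite addnS.
have lW := letter_le k_lt; have nodeE := node_start a_lt i_lt.
have kW c : c < 8 -> P + (8 * (start a + i) + c) <= W by move=> c8;
  apply: leq_trans W_large; lia.
have m'_ai : m' (offset a + 1 + i) = letter (start a + i) by rewrite m'_in //; lia.
wp_step; wp_step; rewrite h6 ?m'_ai; [lia|exact: lW|].
wp_step; wp_step; rewrite ?h1 ?h10; [exact: kW|by []|].
wp_step; wp_step; rewrite ?h1 ?h10 ?h8 -?nodeE; [exact: kW| |].
  by rewrite nodeE; case: (0 < i); rewrite ?muln1 ?muln0 //; lia.
wp_step; wp_step; rewrite ?h6; first lia.
wp_step; wp_step; rewrite ?h10; first lia.
wp_step; rewrite ?h8; first lia.
split; last lia.
have cm'' := copied_next cm'; rewrite !addn0 !addn1 !addnS in cm''.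
by split=> //=; rewrite ?addnS ?addn0 ?h5 ?h7 ?h6 ?h10 ?h8 ?addn1.
Qed.

(** The tables of degrees are initially 0, as if no edge was live; the analysis of
    the graph then starts by counting the edges. *)
Lemma wp_program (Q : store -> nat -> Prop) t : 1000 * (n * n).+1 <= t ->
  (forall (g : nat -> nat) m' t' (ans : bool) E, g 0 = ans ->
     essential n (head 0 (shape ws)) letter node E ->
     (ans <-> deterministic n (head 0 (shape ws)) letter node E) -> Q (MkStore g m') t')
       ->
  wp W (measure_input;; copy_words;; analyze)%cmd Q (MkStore (fun=> 0) (nth 0 input)) t.
Proof.
move=> t_ge post.
have n_nn : n <= n * n by case: (n) => // k; rewrite leq_pmulr.
have sum_n : sumn (shape ws) = n by rewrite /n size_flatten.
have node_id k : node k != 0 -> node k = k by rewrite /node /word_node; case: ifP.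
have node_lt k : k <= n -> 0 < n -> node k < n.
  by rewrite /node /word_node sum_n; case: ifP => // /andP[].
wp_step; apply: (@wp_measure_input _ (900 * (n * n) + 120)) => //; first lia.
move=> f t1 t1_ge fE.
wp_step; apply: (@wp_copy_words _ (800 * (n * n) + 90)) fE _; first lia.
move=> g m t2 t2_ge [g1 g2 g3 g16] [_ mL mS m0].
apply: (wp_analyze node_id node_lt W_large letter_le _ _ post); first lia.
split=> //=.
- split=> // j; rewrite ltnS leq_eqVlt => /predU1P[->|]; last exact: mS.
  by rewrite m0 ?leqnn ?orbT // /node /word_node sum_n ltnn.
- move=> d d1 v _; rewrite m0 //; last by lia.
  by rewrite /deg (eq_count (a2 := pred0)) ?count_pred0 // => e; rewrite andbF.
Qed.

End Reading.

(** * The decision procedure *)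

Definition recognizability_program : cmd :=
  (measure_input;; copy_words;; analyze)%cmd.

Lemma size_le_flatten (T : Type) (ws : seq (seq T)) :
  all (fun w => 0 < size w) ws -> size ws <= size (flatten ws).
Proof. by elim: ws => //= w ws IHws /andP[w_gt0 /IHws]; rewrite size_cat; lia. Qed.

Theorem corollary7p3 :
  exists (p : cmd) (c d : nat),
  forall (A B : finType) (sigma : seq A -> seq B),
    free_monoid_morphism sigma ->
    injective sigma ->
    let n := words_size (letter_images sigma) in
    exists answer : bool,
      computes_within ((n + #|B|).+2 ^ d) p (encode sigma)
        (c * (n ^ 2).+1) answer
      /\ (answer <-> recognizable_for_aperiodic_points sigma).
Proof.
(* All addresses are at most 8 * (n + 2) ^ 2, and 8 <= (n + 2) ^ 3. *)
exists recognizability_program, 1000, 5 => A B sigma sigma_morph sigma_inj n.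
pose ws := [seq [seq (enum_rank b : nat) | b <- w] | w <- words sigma].
have flat_ws : flatten ws = [seq (enum_rank b : nat) | b <- text sigma].
  by rewrite /ws /text map_flatten.
have size_ws : size (flatten ws) = size (text sigma) by rewrite flat_ws size_map.
have shape_ws : shape ws = shape (words sigma).
  by rewrite /shape -map_comp; apply: eq_map => w /=; rewrite size_map.
have n_text : n = size (text sigma).
  rewrite /n /words_size /letter_images undup_id; last first.
    by rewrite map_inj_uniq ?enum_uniq // => a a' /sigma_inj[].
  by rewrite size_text sumnE /shape [RHS]big_map.
have encodeE : encode sigma = [:: size ws, #|B| & listing ws].
  rewrite /encode /ws /words 2!size_map -cardE /listing -!map_comp.
  congr [:: _, _ & flatten _]; apply: eq_map => a /=.
  by rewrite size_map.
have few : size ws <= size (flatten ws).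
  rewrite size_le_flatten // all_map all_map; apply/allP => a _ /=.
  by rewrite size_map; exact: word_gt0.
set W := _ ^ 5.
have W_large : size [:: size ws, #|B| & listing ws] +
    8 * (size (flatten ws) * size (flatten ws) + size (flatten ws) + 2) <= W.
  rewrite /= size_listing; rewrite size_ws -n_text in few *.
  apply: (@leq_trans (8 * (n.+2 * n.+2))); first by rewrite mulSn mulnS; lia.
  apply: (@leq_trans (n.+2 ^ 5)).
    by rewrite (expnD _ 3 2) -mulnn leq_mul // -[8]/(2 ^ 3) leq_exp2r.
  by rewrite leq_exp2r // !ltnS leq_addr.
have letter_le k : k < size (flatten ws) -> nth 0 (flatten ws) k <= W.
  move=> k_lt; apply: (@leq_trans #|B|).
    rewrite flat_ws; rewrite size_ws in k_lt.
    case: (text sigma) k_lt => // b0 s k_lt.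
    by rewrite (nth_map b0) //; apply/ltnW/ltn_ord.
  apply: (@leq_trans ((n + #|B|).+2 ^ 1)); first by rewrite expn1; lia.
  by rewrite leq_pexp2l.
pose decides (out : nat) := exists answer : bool, out = answer /\
  (answer <-> recognizable_for_aperiodic_points sigma).
have [|out run_out [answer [outE ansP]]] := @wp_computes W recognizability_program
    (encode sigma) (1000 * (n ^ 2).+1) decides; last first.
  by exists answer; rewrite -outE.
rewrite encodeE /=; apply: wp_program => //.
  by rewrite size_ws -n_text mulnn.
move=> g m t answer E g0; rewrite size_ws shape_ws flat_ws => ess ansP.
exists answer; split=> //=; rewrite ansP; split.
- exact: deterministic_recognizable.
- exact: recognizable_deterministic.
Qed.
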